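(* Suppose the graded set $\mathcal W$ is bounded and matrix convex. If either (i) $\mathcal W$ is the principal component of a free open semi-algebraic set, or (ii) $\mathcal W$ is the principal component of a graded set of the form $\bigcup_{k=1}^t\bigcap_{j=1}^{s_k}\mathfrak I_{p_{k,j}}$, where $\{p_{k,j}\}$ is a finite collection of symmetric matrix-valued free polynomials with each $p_{k,j}(0)$ invertible, then $\mathcal W$ has an LMI representation.
   Context: Fix a positive integer $g$. $\mathcal P$ denotes the free algebra of polynomials with real coefficients in freely noncommuting variables $x=(x_1,\dots,x_g)$, and $\mathcal P^{\delta\times\delta}$ the $\delta\times\delta$ matrices over $\mathcal P$. Write $p\in\mathcal P^{\delta\times\delta}$ as a finite sum $p=\sum_w p_w w$ over words $w$ with real $\delta\times\delta$ matrices $p_w$. The involution is $p^T=\sum_w p_w^T w^T$, where $w^T$ is the reversed word; $p$ is symmetric if $p^T=p$. $\mathbb S_n(\mathbb R^g)$ is the set of $g$-tuples $X$ of real symmetric $n\times n$ matrices; $p(X)=\sum_w p_w\otimes w(X)$, where $w(X)=X_{j_1}\cdots X_{j_k}$ for $w=x_{j_1}\cdots x_{j_k}$ and $\emptyset(X)=I_n$; $p(0)=p_\emptyset$. A graded set is a sequence $\mathcal S=(\mathcal S(n))_{n\ge1}$ with $\mathcal S(n)\subset\mathbb S_n(\mathbb R^g)$; equality, inclusion, unions and intersections are termwise. Its principal component $pc[\mathcal S]$ is the graded set whose $n$-th term is the connected component of $0$ in $\mathcal S(n)$. For symmetric matrix-valued $p$ with $p(0)$ invertible, $\mathfrak I_p=(\mathfrak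 I_p(n))_n$ with $\mathfrak I_p(n)=\{X\in\mathbb S_n(\mathbb R^g): p(X)\text{ is invertible}\}$, and $\mathcal D_p=pc[\mathfrak I_p]$. A free basic open semi-algebraic set (containing $0$) is a graded set $\bigcap_j\mathcal D_{p_j}$ for a finite set of symmetric matrix-valued polynomials $p_j\in\mathcal P^{\delta_j\times\delta_j}$ with $p_j(0)$ invertible. A free open semi-algebraic set (containing $0$) is a finite union of free basic open semi-algebraic sets. A graded set $\mathcal C$ is a bounded (open) matrix convex set if: each $\mathcal C(m)$ is open and contains $0$; $\mathcal C$ respects direct sums ($X\in\mathcal C(n),Y\in\mathcal C(m)$ imply $X\oplus Y=(X_1\oplus Y_1,\dots,X_g\oplus Y_g)\in\mathcal C(n+m)$); $\mathcal C$ respects simultaneous conjugation with contractions (if $Y\in\mathcal C(m)$ and $F$ is an $m\times k$ contraction then $F^TYF=(F^TY_1F,\dots,F^TY_gF)\in\mathcal C(k)$); and each $\mathcal C(m)$ is convex and bounded. A graded set is bounded if there is a constant $K$ with $\sum_j\|X_j\|\le K$ for all $n$ and all $X$ in the $n$-th term. A monic linear pencil of size $\ell$ is $L(x)=I_\ell+\sum_{j=1}^gA_jx_j$ with $A_j$ real symmetric $\ell\times\ell$ matrices; $\mathcal D_L(n)=\{X\in\mathbb S_n(\mathbb R^g):L(X)\succ0\}$. A graded set $\mathcal C$ has an LMI representation if $\mathcal C=\mathcal D_L$ for some monic linear pencil $L$. *)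

(* Defs.v *)
From HB Require Import structures.
From mathcomp Require Import all_boot all_order all_algebra.
From mathcomp Require Import finmap mxtens.
From mathcomp Require Import all_classical all_reals all_analysis.

Set Implicit Arguments.
Unset Strict Implicit.
Unset Printing Implicit Defensive.

Import Order.TTheory GRing.Theory Num.Theory.
Import numFieldNormedType.Exports.
(* finite tuples of matrices carry the product topology *)
Import ArrowAsProduct.

Local Open Scope classical_set_scope.
Local Open Scope ring_scope.

Section Matrices.
Variable R : realType.

Definition enorm n (v : 'cV[R]_n) : R := Num.sqrt (\sum_i v i 0 ^+ 2).

(* The library norm on 'M[R]_(m, n) is the largest absolute value of an entry;
   this is the operator norm between Euclidean spaces. *)
Definition opnorm m n (A : 'M[R]_(m, n)) : R :=
  sup [set enorm (A *m v) | v in [set v : 'cV[R]_n | enorm v <= 1]].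

Definition contraction m n (F : 'M[R]_(m, n)) : Prop := opnorm F <= 1.

Definition posdef n (A : 'M[R]_n) : Prop :=
  A^T = A /\ forall v : 'cV[R]_n, v != 0 -> 0 < (v^T *m A *m v) 0 0.

End Matrices.

Section Tuples.
Variables (R : realType) (g : nat).

Definition mxtuple n := 'I_g -> 'M[R]_n.

Definition symtuples n : set (mxtuple n) := [set X | forall i, (X i)^T = X i].

Definition dsum n m (X : mxtuple n) (Y : mxtuple m) : mxtuple (n + m) :=
  fun i => block_mx (X i) 0 0 (Y i).

Definition conjtuple m k (F : 'M[R]_(m, k)) (Y : mxtuple m) : mxtuple k :=
  fun i => F^T *m Y i *m F.

End Tuples.

Section Polynomials.
Variables (R : realType) (g : nat).

(* A word x_{j_1} ... x_{j_k} is the sequence [:: j_1; ...; j_k], and a d x d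
   matrix polynomial is the finitely supported family w |-> p_w of its
   matrix coefficients.  The product of polynomials is not needed below. *)
Definition ncpoly d := {fsfun seq 'I_g -> 'M[R]_d with 0}.

Definition ncsym d (p : ncpoly d) : Prop := forall w, (p w)^T = p (rev w).

Definition weval n (w : seq 'I_g) (X : mxtuple R g n) : 'M[R]_n :=
  \prod_(j <- w) X j.

Definition nceval d n (p : ncpoly d) (X : mxtuple R g n) : 'M[R]_(d * n) :=
  \sum_(w <- finsupp p) tensmx (p w) (weval w X).

Definition admissible d (p : ncpoly d) : Prop :=
  [/\ (0 < d)%N, ncsym p & p [::] \in unitmx].

End Polynomials.

Section GradedSets.
Variables (R : realType) (g : nat).

(* Only the terms with 0 < n are meaningful; the term at n = 0 is ignored by
   every predicate below, including equality. *)
Definition graded := forall n : nat, set (mxtuple R g n).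

Definition graded_set (S : graded) : Prop :=
  forall n, (0 < n)%N -> S n `<=` symtuples (n := n).

Definition graded_eq (S T : graded) : Prop :=
  forall n, (0 < n)%N -> S n = T n.

Definition graded_union t (S : 'I_t -> graded) : graded :=
  fun n => \bigcup_k S k n.

(* the intersection with symtuples only matters for the empty family *)
Definition graded_inter s (S : 'I_s -> graded) : graded :=
  fun n => symtuples (n := n) `&` \bigcap_j S j n.

Definition pc (S : graded) : graded :=
  fun n => connected_component (S n) 0.

Definition invset d (p : ncpoly R g d) : graded :=
  fun n => [set X | symtuples X /\ nceval p X \in unitmx].

Definition pcinvset d (p : ncpoly R g d) : graded := pc (invset p).

Definition free_basic_open (S : graded) : Prop :=
  exists (s : nat) (d : 'I_s -> nat) (p : forall j, ncpoly R g (d j)),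
    (forall j, admissible (p j)) /\
    graded_eq S (graded_inter (fun j => pcinvset (p j))).

Definition free_open (S : graded) : Prop :=
  exists (t : nat) (B : 'I_t -> graded),
    (forall k, free_basic_open (B k)) /\ graded_eq S (graded_union B).

Definition graded_bounded (S : graded) : Prop :=
  exists K : R, forall n, (0 < n)%N ->
    forall X, S n X -> \sum_j opnorm (X j) <= K.

(* openness is relative to the space of tuples of symmetric matrices *)
Definition open_term n (A : set (mxtuple R g n)) : Prop :=
  exists2 U : set (mxtuple R g n), open U & A = U `&` symtuples (n := n).

Definition bounded_term n (A : set (mxtuple R g n)) : Prop :=
  exists K : R, forall X, A X -> \sum_j opnorm (X j) <= K.

Record bounded_matrix_convex (C : graded) : Prop := BoundedMatrixConvex {
  bmc_open : forall m, (0 < m)%N -> open_term (C m);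
  bmc_0 : forall m, (0 < m)%N -> C m 0;
  bmc_dsum : forall n m, (0 < n)%N -> (0 < m)%N ->
    forall X Y, C n X -> C m Y -> C (n + m)%N (dsum X Y);
  bmc_conj : forall m k, (0 < m)%N -> (0 < k)%N ->
    forall (F : 'M[R]_(m, k)) Y,
      C m Y -> contraction F -> C k (conjtuple F Y);
  bmc_convex : forall m, (0 < m)%N -> convex_set (C m);
  bmc_bounded : forall m, (0 < m)%N -> bounded_term (C m) }.

Definition pencil l n (A : mxtuple R g l) (X : mxtuple R g n) : 'M[R]_(l * n) :=
  tensmx 1%:M 1%:M + \sum_j tensmx (A j) (X j).

Definition pencil_domain l (A : mxtuple R g l) : graded :=
  fun n => [set X | symtuples X /\ posdef (pencil A X)].

Definition LMI_representation (C : graded) : Prop :=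
  exists l, (0 < l)%N /\
  exists2 A : mxtuple R g l, symtuples A & graded_eq C (pencil_domain A).

End GradedSets.

(* Main.v *)
(** All that is used of the semialgebraic description of [W] is that a subset of
    [W] accumulating at a point outside [W] makes one of the finitely many
    polynomials [p i] become singular.

    Effros-Winkler: at a boundary point [X] the convex cone of the pairs
    [(F^T F, F^T Y F)], with [Y] in [W], does not contain [(1, X)]; a separating
    functional is a monic pencil, positive on [W] and singular at [X].

    To get one pencil for many boundary points, let [p i (X) V i = 0] for all
    [i], and let [P] be the projection onto the span of the vectors [w(X) v],
    for [v] among the components of [V] and [w] a word of length at most the
    degree.  The path [P_s X P_s], with [P_s = P + s (1 - P)], does not change
    [p i (.) V i]; hence if [V i] is nonzero for every [i] whose polynomial is
    singular at some boundary point considered, the path cannot leave [W], so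
    that [P X P] is again a boundary point.  The Effros-Winkler pencil [B] at
    [P X P] then has a kernel vector at [X] with components of the form [q(X) V],
    [q] of bounded degree, and [B(X) q(X) V = 0] is a linear relation between
    the vectors [w(X) v].  Choosing [X] as a direct sum for which these satisfy
    as few relations as possible, this relation holds at all boundary points
    considered: each is caught by [B], or satisfies the additional relation
    [q(X) V = 0].  After finitely many steps no boundary point is left. *)

Require Import Defs.
From mathcomp Require Import all_boot all_order all_algebra.
From mathcomp Require Import finmap mxtens.
From mathcomp Require Import all_classical all_reals all_analysis.
From mathcomp Require Import ring lra.

Set Implicit Arguments.
Unset Strict Implicit.
Unset Printing Implicit Defensive.

Import Order.TTheory GRing.Theory Num.Theory.
Import numFieldNormedType.Exports.
Import ArrowAsProduct.

Local Open Scope classical_set_scope.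
Local Open Scope ring_scope.

(** * Separation of convex sets in R^n *)

Section Separation.
Variable R : realType.

Definition dot n (u v : 'rV[R]_n) : R := \sum_i u 0 i * v 0 i.

Lemma dotC n (u v : 'rV[R]_n) : dot u v = dot v u.
Proof. by apply: eq_bigr => i _; rewrite mulrC. Qed.

Lemma dotDl n (u v w : 'rV[R]_n) : dot (u + v) w = dot u w + dot v w.
Proof. by rewrite -big_split; apply: eq_bigr => i _; rewrite mxE mulrDl. Qed.

Lemma dotZl n a (u w : 'rV[R]_n) : dot (a *: u) w = a * dot u w.
Proof. by rewrite mulr_sumr; apply: eq_bigr => i _; rewrite mxE mulrA. Qed.

Lemma dotDr n (u v w : 'rV[R]_n) : dot w (u + v) = dot w u + dot w v.
Proof. by rewrite dotC dotDl !(dotC _ w). Qed.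

Lemma dotZr n a (u w : 'rV[R]_n) : dot w (a *: u) = a * dot w u.
Proof. by rewrite dotC dotZl dotC. Qed.

Lemma dot_line n (u v : 'rV[R]_n) t :
  dot (u + t *: v) (u + t *: v) = dot u u + t * (2 * dot u v + t * dot v v).
Proof. by rewrite dotDl !dotDr !dotZl !dotZr (dotC v u); ring. Qed.

Lemma dot_ge0 n (u : 'rV[R]_n) : 0 <= dot u u.
Proof. by apply: sumr_ge0 => i _; rewrite -expr2 sqr_ge0. Qed.

Lemma dot_eq0 n (u : 'rV[R]_n) : dot u u = 0 -> u = 0.
Proof.
move=> /eqP; rewrite psumr_eq0 => [/allP u0|i _]; last by rewrite -expr2 sqr_ge0.
apply/rowP => i; rewrite mxE; apply/eqP; rewrite -sqrf_eq0 expr2.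
by apply: u0; rewrite mem_index_enum.
Qed.

Lemma continuous_sum (T : topologicalType) (I : finType) (F : I -> T -> R) :
  (forall i, continuous (F i)) -> continuous (fun x => \sum_i F i x).
Proof. by move=> cF; apply: continuous_big => //; exact: add_continuous. Qed.

Lemma continuous_dot (T : topologicalType) n (f h : T -> 'rV[R]_n) :
  (forall i, continuous (fun x => f x 0 i)) ->
  (forall i, continuous (fun x => h x 0 i)) ->
  continuous (fun x => dot (f x) (h x)).
Proof.
by move=> cf ch; apply: continuous_sum => i x; apply: continuousM; [exact: cf|exact: ch].
Qed.

Lemma continuous_coord n (i : 'I_n) : continuous (fun x : 'rV[R]_n => x 0 i).
Proof. exact: coord_continuous. Qed.

Lemma closed_le_continuous (T : topologicalType) (f : T -> R) :
  continuous f -> closed [set x | 0 <= f x].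
Proof.
move=> cf; apply: (@preimage_closed _ _ f [set y | 0 <= y]) => [x _|]; first exact: cf.
exact: closed_ge.
Qed.

Lemma closed_eq_continuous (T : topologicalType) (f : T -> R) a :
  continuous f -> closed [set x | f x = a].
Proof.
move=> cf; apply: (@preimage_closed _ _ f [set y | y = a]) => [x _|]; first exact: cf.
exact: closed_eq.
Qed.

Definition simplex r : set 'rV[R]_r :=
  [set a | (forall i, 0 <= a 0 i) /\ \sum_i a 0 i = 1].

Lemma compact_simplex r : compact (@simplex r).
Proof.
have cube : compact [set v : 'rV[R]_r | forall i, v ord0 i \in `[0, 1]].
  apply: (@rV_compact R r (fun=> `[0, 1]%classic)) => _.
  exact: segment_compact.
apply: subclosed_compact cube _.
  rewrite (_ : @simplex r =
    (\bigcap_(i : 'I_r) [set a : 'rV_r | 0 <= a 0 i]) `&`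
    [set a | \sum_i a 0 i = 1]); last first.
    by apply/seteqP; split=> a [a0 a1]; split=> // i; [move=> _|]; exact: a0.
  apply: closedI.
    apply: closed_bigI => i _; apply: closed_le_continuous.
    exact: continuous_coord.
  apply: closed_eq_continuous; apply: continuous_sum => i.
  exact: continuous_coord.
move=> a [a0 a1] i /=; rewrite in_itv/= a0 -a1 (bigD1 i)//= lerDl.
exact: sumr_ge0.
Qed.

Definition convex_subset n (C : set 'rV[R]_n) : Prop := forall x y t,
  0 <= t <= 1 -> C x -> C y -> C (t *: x + (1 - t) *: y).

Lemma convex_subset_comb n (C : set 'rV[R]_n) r (c : 'I_r -> 'rV[R]_n) a :
  convex_subset C -> (forall i, C (c i)) -> simplex a ->
  C (\sum_i a 0 i *: c i).
Proof.
move=> Cconv; elim: r c a => [|r IH] c a Cc [a0 a1].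
  by move: a1 => /eqP; rewrite big_ord0 eq_sym oner_eq0.
rewrite big_ord_recl; rewrite big_ord_recl in a1.
have [a01|a01] := eqVneq (a 0 ord0) 1.
  have z i : a 0 (lift ord0 i) = 0.
    have : \sum_(i < r) a 0 (lift ord0 i) = 0.
      by apply: (addrI (a 0 ord0)); rewrite addr0 {2}a01.
    by move/eqP; rewrite psumr_eq0 // => /allP/(_ i (mem_index_enum _))/eqP.
  rewrite a01 scale1r big1 ?addr0 => [|i _]; first exact: Cc.
  by rewrite z scale0r.
pose b := \row_(i < r) (a 0 (lift ord0 i) / (1 - a 0 ord0)).
have le1 : a 0 ord0 <= 1 by rewrite -a1 lerDl sumr_ge0.
have pos : 0 < 1 - a 0 ord0 by rewrite subr_gt0 lt_neqAle a01.
have -> : \sum_(i < r) a 0 (lift ord0 i) *: c (lift ord0 i) =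
    (1 - a 0 ord0) *: \sum_(i < r) b 0 i *: c (lift ord0 i).
  rewrite scaler_sumr; apply: eq_bigr => i _; rewrite scalerA mxE.
  by rewrite mulrC divfK ?gt_eqF.
apply: Cconv; [by rewrite a0 le1|exact: Cc|apply: IH => [i|]; first exact: Cc].
split=> [i|]; first by rewrite mxE divr_ge0 // ltW.
under eq_bigr do rewrite mxE.
rewrite -mulr_suml; have -> : \sum_(i < r) a 0 (lift ord0 i) = 1 - a 0 ord0.
  by rewrite -a1 addrAC subrr add0r.
by rewrite divff // gt_eqF.
Qed.

(** The witness [l] is the point of least norm in the convex hull of the [c i]: moving from it
    towards a vertex cannot decrease the norm. *)
Lemma finite_separation n (C : set 'rV[R]_n) r (c : 'I_r.+1 -> 'rV[R]_n) :
  convex_subset C -> (forall i, C (c i)) ->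
  exists2 l, C l & forall i, 0 <= dot l (c i).
Proof.
move=> Cconv Cc; pose h (a : 'rV[R]_r.+1) := \sum_i a 0 i *: c i.
have ch i : continuous (fun a => h a 0 i).
  have -> : (fun a => h a 0 i) = fun a : 'rV[R]_r.+1 => \sum_j a 0 j * c j 0 i.
    by apply/funext => a; rewrite summxE; apply: eq_bigr => j _; rewrite mxE.
  apply: continuous_sum => j x; apply: continuousM; first exact: continuous_coord.
  exact: cst_continuous.
have vertex i : simplex (delta_mx 0 i : 'rV[R]_r.+1).
  split=> [j|]; first by rewrite mxE ler0n.
  by rewrite (bigD1 i)//= mxE !eqxx big1 ?addr0 // => j ji; rewrite mxE (negPf ji) andbF.
have hvertex i : h (delta_mx 0 i) = c i.
  rewrite /h (bigD1 i)//= mxE !eqxx scale1r big1 ?addr0 // => j ji.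
  by rewrite mxE (negPf ji) andbF scale0r.
have hD x y : h (x + y) = h x + h y.
  by rewrite -big_split; apply: eq_bigr => j _; rewrite mxE scalerDl.
have hZ k x : h (k *: x) = k *: h x.
  by rewrite scaler_sumr; apply: eq_bigr => j _; rewrite mxE scalerA.
have [||| a] := @EVT_min_rV R r.+1 (fun a => dot (h a) (h a)) (@simplex r.+1).
- by exists (delta_mx 0 0).
- exact: compact_simplex.
- apply: continuous_subspaceT; exact: continuous_dot.
rewrite inE => sa amin; exists (h a); first exact: convex_subset_comb.
move=> i; set d := c i - h a.
have key t : 0 <= t <= 1 -> 0 <= t * (2 * dot (h a) d + t * dot d d).
  move=> /andP[t0 t1].
  have sb : simplex ((1 - t) *: a + t *: delta_mx 0 i).
    have [a0 a1] := sa; have [v0 v1] := vertex i; split=> [j|].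
      by rewrite !mxE addr_ge0 ?mulr_ge0 ?subr_ge0 //; have := v0 j; rewrite mxE.
    transitivity ((1 - t) * \sum_j a 0 j + t * \sum_j (delta_mx 0 i : 'rV[R]_r.+1) 0 j).
      rewrite !mulr_sumr -big_split; apply: eq_bigr => j _.
      by rewrite mxE [in LHS]mxE [in X in _ + X]mxE.
    by rewrite a1 v1; ring.
  have := amin _ (mem_set sb).
  have -> : h ((1 - t) *: a + t *: delta_mx 0 i) = h a + t *: d.
    rewrite hD !hZ hvertex /d scalerBl scale1r scalerBr -!addrA.
    by congr (_ + _); rewrite addrC.
  by rewrite dot_line lerDl.
rewrite leNgt; apply/negP => neg.
have hd : dot (h a) d < 0.
  rewrite dotDr -scaleN1r dotZr; have := dot_ge0 (h a); lra.
have dd := dot_ge0 d; set x := dot (h a) d in hd key; set y := dot d d in dd key.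
(* A step of length at most 1 with [t * y < - x]; as [x < 0], it would decrease the squared norm. *)
pose t := - x / (y - x + 1).
have den : 0 < y - x + 1 by lra.
have t0 : 0 < t by rewrite divr_gt0 //; lra.
have t1 : t <= 1 by rewrite ler_pdivrMr // mul1r; lra.
have /key : 0 <= t <= 1 by rewrite ltW.
rewrite pmulr_rge0 // => k.
have ty : t * (y - x + 1) = - x by rewrite divfK // gt_eqF.
by nra.
Qed.

(* The minimal-norm points of finitely generated hulls give functionals that
   are nonnegative on finitely many points of [C]; compactness of the unit
   sphere of [U] makes one functional work for all of [C]. *)
Lemma weak_separation n (C U : set 'rV[R]_n) :
  convex_subset C -> C !=set0 -> ~ C 0 ->
  closed U -> (forall a u, U u -> U (a *: u)) -> C `<=` U ->
  exists l, [/\ U l, l != 0 & forall x, C x -> 0 <= dot l x].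
Proof.
move=> Cconv [c0 Cc0] C0 Ucl Uscale CU.
pose K := U `&` [set l : 'rV[R]_n | dot l l = 1].
have Kcl : closed K.
  apply: closedI => //; apply: closed_eq_continuous; apply: continuous_dot;
    exact: continuous_coord.
have Kco : compact K.
  have cube : compact [set v : 'rV[R]_n | forall i, v ord0 i \in `[-1, 1]].
    apply: (@rV_compact R n (fun=> `[-1, 1]%classic)) => _.
    exact: segment_compact.
  apply: subclosed_compact cube _ => // l [_ /= l1] i.
  rewrite /= in_itv/= -ler_norml -sqrtr_sqr -sqrtr1 ler_wsqrtr // -l1.
  by rewrite /dot (bigD1 i)//= expr2 lerDl sumr_ge0 // => j _; rewrite -expr2 sqr_ge0.
move: Kco; rewrite compact_In0 /= => /(_ _ C (fun c => K `&` [set l | 0 <= dot l c])).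
case.
- exists (fun c => [set l | 0 <= dot l c]) => // c _; apply: closed_le_continuous.
  apply: continuous_dot => i; first exact: continuous_coord.
  exact: cst_continuous.
- move=> D DC.
  (* [c0] is put in front because [finite_separation] needs at least one point. *)
  pose s := c0 :: enum_fset D.
  have sC i : (i < size s)%N -> C (s`_i).
    move=> /(mem_nth 0); rewrite inE => /orP[/eqP-> //|/DC]; exact: set_mem.
  have [l Cl lpos] := @finite_separation _ C _
    (fun i : 'I_(size (enum_fset D)).+1 => s`_i) Cconv (fun i => sC i (ltn_ord i)).
  have l0 : 0 < dot l l.
    rewrite lt_neqAle dot_ge0 andbT; apply/eqP => /esym/dot_eq0 l0.
    by apply: C0; rewrite -l0.
  exists ((Num.sqrt (dot l l))^-1 *: l) => c /= cD; split.
    split; first exact/Uscale/CU.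
    by rewrite /= dotZl dotZr mulrA -expr2 exprVn sqr_sqrtr ?ltW // mulVf // gt_eqF.
  rewrite /= dotZl mulr_ge0 ?invr_ge0 ?sqrtr_ge0 //.
  have /(nthP 0)[i i_s <-] : c \in s by rewrite inE cD orbT.
  exact: (lpos (Ordinal i_s)).
move=> l lK; exists l; have [[Ul l1] _] := lK _ Cc0; split=> //.
  apply/eqP => l0; move: l1; rewrite /= l0 -(scale0r 0) dotZl mul0r => /eqP.
  by rewrite eq_sym oner_eq0.
by move=> x /lK[].
Qed.

End Separation.

(** * The trace inner product *)

Section Forms.
Variable R : realType.

Definition ip m n (Y Z : 'M[R]_(m, n)) : R := \tr (Y^T *m Z).

Lemma ipE m n (Y Z : 'M[R]_(m, n)) : ip Y Z = \sum_i \sum_j Y j i * Z j i.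
Proof.
by apply: eq_bigr => i _; rewrite mxE; apply: eq_bigr => j _; rewrite mxE.
Qed.

Lemma ipC m n (Y Z : 'M[R]_(m, n)) : ip Y Z = ip Z Y.
Proof. by rewrite /ip -mxtrace_tr trmx_mul trmxK. Qed.

Lemma ipDl m n (X Y Z : 'M[R]_(m, n)) : ip (X + Y) Z = ip X Z + ip Y Z.
Proof. by rewrite /ip linearD /= mulmxDl linearD. Qed.

Lemma ipDr m n (X Y Z : 'M[R]_(m, n)) : ip X (Y + Z) = ip X Y + ip X Z.
Proof. by rewrite ipC ipDl !(ipC X). Qed.

Lemma ipZl m n a (X Y : 'M[R]_(m, n)) : ip (a *: X) Y = a * ip X Y.
Proof. by rewrite /ip linearZ /= -scalemxAl linearZ. Qed.

Lemma ipZr m n a (X Y : 'M[R]_(m, n)) : ip X (a *: Y) = a * ip X Y.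
Proof. by rewrite ipC ipZl ipC. Qed.

Lemma ip_sumr m n I (r : seq I) (X : 'M[R]_(m, n)) F :
  ip X (\sum_(i <- r) F i) = \sum_(i <- r) ip X (F i).
Proof. by rewrite /ip mulmx_sumr linear_sum. Qed.

Lemma ip0r m n (X : 'M[R]_(m, n)) : ip X 0 = 0.
Proof. by rewrite /ip mulmx0 linear0. Qed.

Lemma ip_ge0 m n (Z : 'M[R]_(m, n)) : 0 <= ip Z Z.
Proof.
by rewrite ipE; apply: sumr_ge0 => i _; apply: sumr_ge0 => j _; rewrite -expr2 sqr_ge0.
Qed.

Lemma ip_eq0 m n (Z : 'M[R]_(m, n)) : (ip Z Z == 0) = (Z == 0).
Proof.
apply/eqP/eqP => [|->]; last by rewrite ip0r.
rewrite ipE => /eqP; rewrite psumr_eq0 => [/allP z0|i _]; last first.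
  by apply: sumr_ge0 => j _; rewrite -expr2 sqr_ge0.
apply/matrixP => i j; rewrite mxE; apply/eqP.
have := z0 j (mem_index_enum _); rewrite /= psumr_eq0 => [/allP z0'|k _]; last first.
  by rewrite -expr2 sqr_ge0.
by have := z0' i (mem_index_enum _); rewrite /= -expr2 sqrf_eq0.
Qed.

Lemma ip_gt0 m n (Z : 'M[R]_(m, n)) : Z != 0 -> 0 < ip Z Z.
Proof. by move=> Z0; rewrite lt_neqAle ip_ge0 andbT eq_sym ip_eq0. Qed.

Lemma ip_mulr m n k (Y : 'M[R]_(m, k)) (Z : 'M[R]_(m, n)) (B : 'M[R]_(n, k)) :
  ip Y (Z *m B) = ip (Y *m B^T) Z.
Proof. by rewrite /ip trmx_mul trmxK mulmxA mxtrace_mulC mulmxA. Qed.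

Lemma ip_mull m n k (Y : 'M[R]_(m, n)) (Z : 'M[R]_(k, n)) (B : 'M[R]_(m, k)) :
  ip Y (B *m Z) = ip (B^T *m Y) Z.
Proof. by rewrite /ip trmx_mul trmxK mulmxA. Qed.

Lemma ip_row_mx m n k (Y Z : 'M[R]_(m, n)) (Y' Z' : 'M[R]_(m, k)) :
  ip (row_mx Y Y') (row_mx Z Z') = ip Y Z + ip Y' Z'.
Proof. by rewrite /ip tr_row_mx mul_col_row mxtrace_block. Qed.

Lemma ip_col_mx m n k (Y Z : 'M[R]_(m, n)) (Y' Z' : 'M[R]_(k, n)) :
  ip (col_mx Y Y') (col_mx Z Z') = ip Y Z + ip Y' Z'.
Proof. by rewrite /ip tr_col_mx mul_row_col linearD. Qed.

(** The first-order condition at a zero of a nonnegative form, [t] being the size of the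
    perturbation. *)
Lemma quad_ge0_lin (b c : R) : (forall t, 0 <= b * t + c * t ^+ 2) -> b = 0.
Proof.
move=> H; have [c0|c0] := leP c 0.
  by have := H 1; have := H (-1); rewrite !expr2 => *; lra.
have := H (- b / (2 * c)); have -> : b * (- b / (2 * c)) + c * (- b / (2 * c)) ^+ 2 =
  - (b ^+ 2 / (4 * c)) by field; lra.
rewrite oppr_ge0 => le0; apply/eqP; rewrite -sqrf_eq0; apply/eqP/le_anti.
rewrite sqr_ge0 andbT; move: le0; rewrite pmulr_lle0 // invr_gt0; lra.
Qed.

Definition qform n (S : 'M[R]_n) (u : 'rV[R]_n) : R := (u *m S *m u^T) 0 0.

Lemma qformE n (S : 'M[R]_n) u : qform S u = ip u (u *m S).
Proof. by rewrite /ip mxtrace_mulC trace_mx11. Qed.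

Lemma qformZ n (S : 'M[R]_n) t u : qform S (t *: u) = t ^+ 2 * qform S u.
Proof. by rewrite !qformE -scalemxAl ipZl ipZr mulrA expr2. Qed.

(** Induction by Schur complements, as for the Cholesky factorization. The right inverse [Q']
    records that [Q] has full row rank even if [S] is singular. *)
Lemma psd_factor n (S : 'M[R]_n) :
  S^T = S -> (forall u, 0 <= qform S u) ->
  exists r (Q : 'M[R]_(r, n)) (Q' : 'M[R]_(n, r)), S = Q^T *m Q /\ Q *m Q' = 1%:M.
Proof.
elim: n S => [|n IH] S Ssym Spos.
  by exists 0%N, 0, 0; split; apply/matrixP => [[]].
rewrite -[S](@submxK R 1 n 1 n) in Ssym Spos *.
move: Ssym Spos; set a := ulsubmx _; set b := ursubmx _; set b' := dlsubmx _.
set C := drsubmx _; rewrite (@tr_block_mx R 1 n 1 n).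
move=> /(@eq_block_mx R 1 n 1 n)[_ _ bb' Csym] Spos.
have form (s : 'M[R]_1) (v : 'rV[R]_n) : qform (block_mx a b b' C) (row_mx s v) =
    a 0 0 * s 0 0 ^+ 2 + 2 * (b *m v^T) 0 0 * s 0 0 + qform C v.
  rewrite /qform (@mul_row_block R 1 1 n 1 n) tr_row_mx mul_row_col !mulmxDl -bb'.
  rewrite (mx11_scalar s) (mx11_scalar a) tr_scalar_mx !mul_scalar_mx !mul_mx_scalar.
  have -> : v *m b^T = (b *m v^T)^T by rewrite trmx_mul trmxK.
  rewrite -scalemxAl !mxE eqxx !mulr1n; ring.
have a0 : 0 <= a 0 0.
  have := Spos (row_mx 1%:M 0); rewrite form /qform trmx0 mulmx0 !mul0mx !mxE.
  by rewrite mulr0 mul0r !addr0 expr1n mulr1.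
move: a0; rewrite le_eqVlt => /predU1P[/esym a0|a0].
  have b0 : b = 0.
    apply/rowP => i; rewrite [RHS]mxE; apply/eqP.
    suff : 2 * b 0 i = 0 by move/eqP; rewrite mulf_eq0 pnatr_eq0.
    apply: (@quad_ge0_lin _ (qform C (delta_mx 0 i))) => t.
    have := Spos (row_mx 1%:M (t *: delta_mx 0 i)); rewrite form a0 qformZ.
    rewrite linearZ /= -scalemxAr trmx_delta -colE !mxE eqxx mulr1 mul0r add0r.
    by rewrite [t * _]mulrC mulrA [t ^+ 2 * _]mulrC.
  have Cpos v : 0 <= qform C v.
    by have := Spos (row_mx (0 : 'M[R]_1) v); rewrite form a0 !mxE mulr0 expr2 !mulr0 !add0r.
  have [r [Q [Q' [-> QQ']]]] := IH C Csym Cpos.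
  exists r, (row_mx (0 : 'M[R]_(r, 1)) Q), (col_mx (0 : 'M[R]_(1, r)) Q'); split; last first.
    by rewrite (@mul_row_col R r 1 n r) mul0mx add0r.
  rewrite (@tr_row_mx R r 1 n) (@mul_col_row R 1 n r 1 n) trmx0 !mul0mx mulmx0 -bb' b0 trmx0.
  by rewrite (mx11_scalar a) a0 raddf0.
pose q := Num.sqrt (a 0 0); have q0 : 0 < q by rewrite sqrtr_gt0.
have qq : q * q = a 0 0 by rewrite -expr2 sqr_sqrtr // ltW.
(* The Schur complement is the form minimized over the corner coordinate. *)
have Cpos v : 0 <= qform (C - (a 0 0)^-1 *: (b^T *m b)) v.
  have := Spos (row_mx (- (a 0 0)^-1 *: (b *m v^T)) v); rewrite form.
  have -> : qform (C - (a 0 0)^-1 *: (b^T *m b)) v =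
      qform C v - (a 0 0)^-1 * (b *m v^T) 0 0 ^+ 2.
    rewrite !qformE mulmxBr -scalemxAr -scaleN1r !ipDr !ipZr mulmxA [ip v (_ *m b)]ip_mulr.
    have -> : v *m b^T = (b *m v^T)^T by rewrite trmx_mul trmxK.
    rewrite [ip _^T _]ipE !big_ord1 [_^T _ _]mxE; ring.
  have -> : (- (a 0 0)^-1 *: (b *m v^T)) 0 0 = - (a 0 0)^-1 * (b *m v^T) 0 0 by rewrite mxE.
  set x := (b *m v^T) 0 0; set y := a 0 0 in a0 *.
  suff -> : y * (- y^-1 * x) ^+ 2 + 2 * x * (- y^-1 * x) = - (y^-1 * x ^+ 2).
    by rewrite addrC.
  by field; rewrite gt_eqF.
have [|r [Q [Q' [CQ QQ']]]] := IH _ _ Cpos; first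
  by rewrite linearB linearZ /= trmx_mul trmxK Csym.
exists (1 + r)%N, (block_mx q%:M (q^-1 *: b) 0 Q),
  (block_mx q^-1%:M (- (a 0 0)^-1 *: (b *m Q')) 0 Q'); split.
  rewrite (@tr_block_mx R 1 r 1 n) (@mulmx_block R 1 n 1 r 1 n) trmx0.
  rewrite !mul0mx !mulmx0 !addr0 -CQ -bb'.
  rewrite tr_scalar_mx !mul_scalar_mx !mul_mx_scalar.
  rewrite [(q^-1 *: b)^T]linearZ /= -scalemxAl -scalemxAr.
  rewrite !scalerA divff ?gt_eqF // !scale1r -invfM qq addrC subrK.
  by rewrite scale_scalar_mx qq -mx11_scalar.
rewrite (@mulmx_block R 1 r 1 n 1 r) !mul0mx !mulmx0 !addr0 add0r QQ' !mul_scalar_mx.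
rewrite scale_scalar_mx divff ?gt_eqF // -scalemxAl scalerA -scalerDl.
rewrite -qq (_ : _ + _ = 0) ?scale0r -?scalar_mx_block //.
by rewrite mulrN invfM mulrA divff ?gt_eqF // mul1r addNr.
Qed.

(** The projection onto the row space of [M] is [b^T (b b^T)^-1 b] for a basis [b] of that space. *)
Lemma orth_projection k n (M : 'M[R]_(k, n)) : exists P : 'M[R]_n,
  [/\ P^T = P, P *m P = P, M *m P = M & exists D, P = D *m M].
Proof.
have [r [b [bfree /submxP[F MF] /submxP[E bE]]]] : exists r (b : 'M[R]_(r, n)),
    [/\ row_free b, (M <= b)%MS & (b <= M)%MS].
  by exists (\rank M), (row_base M); rewrite row_base_free !eq_row_base.
have bu : b *m b^T \in unitmx.
  rewrite -row_free_unit; apply: inj_row_free => v.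
  rewrite mulmxA => vbb; have /eqP : ip (v *m b) (v *m b) = 0.
    by rewrite ip_mulr -[b in X in ip X _]trmxK trmxK vbb ipC ip0r.
  rewrite ip_eq0 => /eqP vb; apply: (row_free_inj bfree).
  by rewrite vb mul0mx.
pose G := invmx (b *m b^T).
have Gsym : G^T = G by rewrite /G trmx_inv trmx_mul trmxK.
exists (b^T *m G *m b); split.
- by rewrite !trmx_mul trmxK Gsym mulmxA.
- by rewrite !mulmxA -(mulmxA _ b) mulmxKV.
- by rewrite {1}MF !mulmxA -(mulmxA _ b) mulmxK // -MF.
- by exists (b^T *m G *m E); rewrite {2}bE mulmxA.
Qed.

End Forms.

(** * Monic linear pencils *)

Section Pencils.
Variables (R : realType) (g : nat).
Implicit Types l m n k : nat.

(** For symmetric [X], the action of the pencil at [X] when vectors of the tensor product are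
    written as [l] by [n] matrices. *)
Definition pencil_apply l n (A : mxtuple R g l) (X : mxtuple R g n)
  (Z : 'M[R]_(l, n)) : 'M[R]_(l, n) := Z + \sum_j A j *m Z *m X j.

Definition pencil_form l n (A : mxtuple R g l) (X : mxtuple R g n)
  (Z : 'M[R]_(l, n)) : R := ip Z (pencil_apply A X Z).

Definition pencil_pos l n (A : mxtuple R g l) (X : mxtuple R g n) : Prop :=
  forall Z, Z != 0 -> 0 < pencil_form A X Z.

Lemma pencil_applyD l n (A : mxtuple R g l) (X : mxtuple R g n) Z Z' :
  pencil_apply A X (Z + Z') = pencil_apply A X Z + pencil_apply A X Z'.
Proof.
rewrite /pencil_apply addrACA -big_split; congr (_ + _).
by apply: eq_bigr => j _; rewrite mulmxDr mulmxDl.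
Qed.

Lemma pencil_applyZ l n (A : mxtuple R g l) (X : mxtuple R g n) a Z :
  pencil_apply A X (a *: Z) = a *: pencil_apply A X Z.
Proof.
rewrite /pencil_apply scalerDr scaler_sumr; congr (_ + _).
by apply: eq_bigr => j _; rewrite -scalemxAr -scalemxAl.
Qed.

Lemma pencil_applyC l n (A : mxtuple R g l) (X : mxtuple R g n) Y Z :
  symtuples A -> symtuples X ->
  ip Y (pencil_apply A X Z) = ip (pencil_apply A X Y) Z.
Proof.
move=> As Xs; rewrite ipDr ipDl; congr (_ + _); rewrite ip_sumr [RHS]ipC ip_sumr.
by apply: eq_bigr => j _; rewrite ip_mulr ip_mull As Xs ipC -mulmxA.
Qed.

(** Moving from [Z] in the direction of its image [Y] changes the form to first order by
    [2 * ip Y Y], so [Y] must vanish. *)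
Lemma pencil_form_ge0_ker l n (A : mxtuple R g l) (X : mxtuple R g n) Z :
  symtuples A -> symtuples X -> (forall Y, 0 <= pencil_form A X Y) ->
  pencil_form A X Z = 0 -> pencil_apply A X Z = 0.
Proof.
move=> As Xs pos Z0; set Y := pencil_apply A X Z.
suff : 2 * ip Y Y = 0.
  by move/eqP; rewrite mulf_eq0 pnatr_eq0 ip_eq0 => /eqP.
apply: (@quad_ge0_lin _ _ (pencil_form A X Y)) => t.
suff <- : pencil_form A X (Z + t *: Y) = 2 * ip Y Y * t + pencil_form A X Y * t ^+ 2.
  exact: pos.
rewrite [in LHS]/pencil_form pencil_applyD pencil_applyZ.
rewrite (ipDl Z) !(ipDr _ (pencil_apply A X Z)) !ipZl !ipZr -!/(pencil_form A X _).
rewrite Z0 (pencil_applyC Z Y As Xs) -/Y.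
by set a := ip Y Y; set b := pencil_form A X Y; clearbody a b; ring.
Qed.

Lemma pencil_form_dsum l n k (A : mxtuple R g l) (X : mxtuple R g n)
    (Y : mxtuple R g k) Z Z' :
  pencil_form A (dsum X Y) (row_mx Z Z') = pencil_form A X Z + pencil_form A Y Z'.
Proof.
rewrite /pencil_form -ip_row_mx; congr ip.
rewrite /pencil_apply -add_row_mx; congr (_ + _).
elim/big_ind3: _ => [|? ? ? ? ? ? -> ->|j _]; first by rewrite row_mx0.
- by rewrite add_row_mx.
by rewrite mul_mx_row mul_row_block !mulmx0 addr0 add0r.
Qed.

Lemma pencil_pos_dsum l n k (A : mxtuple R g l) (X : mxtuple R g n)
    (Y : mxtuple R g k) :
  pencil_pos A X -> pencil_pos A Y -> pencil_pos A (dsum X Y).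
Proof.
move=> AX AY Z; rewrite -[Z]hsubmxK pencil_form_dsum => Z0.
have ge0 n' (X' : mxtuple R g n') Z' : pencil_pos A X' -> 0 <= pencil_form A X' Z'.
  move=> AX'; have [->|/AX'/ltW //] := eqVneq Z' 0.
  by rewrite /pencil_form ipC ip0r.
have [z|z] := eqVneq (lsubmx Z) 0; last by rewrite ltr_pwDl ?AX ?ge0.
rewrite ltr_wpDl ?ge0 // AY //; apply: contra_neq Z0 => ->.
by rewrite z row_mx0.
Qed.

Lemma pencil_form_dsuml l k n (A : mxtuple R g l) (B : mxtuple R g k)
    (X : mxtuple R g n) Z Z' :
  pencil_form (dsum A B) X (col_mx Z Z') = pencil_form A X Z + pencil_form B X Z'.
Proof.
rewrite /pencil_form -ip_col_mx; congr ip.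
rewrite /pencil_apply -add_col_mx; congr (_ + _).
elim/big_ind3: _ => [|? ? ? ? ? ? -> ->|j _]; first by rewrite col_mx0.
- by rewrite add_col_mx.
by rewrite mul_block_col !mul0mx addr0 add0r mul_col_mx.
Qed.

Lemma pencil_pos_dsuml l k n (A : mxtuple R g l) (B : mxtuple R g k)
    (X : mxtuple R g n) :
  pencil_pos (dsum A B) X <-> pencil_pos A X /\ pencil_pos B X.
Proof.
split=> [AB|[AX BX] Z].
  split=> Z Z0.
    have := AB (col_mx Z 0); rewrite pencil_form_dsuml {2}/pencil_form ipC ip0r addr0.
    apply; apply: contra_neq Z0 => /eqP; rewrite col_mx_eq0 => /andP[/eqP] //.
  have := AB (col_mx 0 Z); rewrite pencil_form_dsuml {1}/pencil_form ipC ip0r add0r.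
  apply; apply: contra_neq Z0 => /eqP; rewrite col_mx_eq0 => /andP[_ /eqP] //.
rewrite -[Z]vsubmxK pencil_form_dsuml => Z0.
have ge0 l' (A' : mxtuple R g l') Z' : pencil_pos A' X -> 0 <= pencil_form A' X Z'.
  move=> AX'; have [->|/AX'/ltW //] := eqVneq Z' 0.
  by rewrite /pencil_form ipC ip0r.
have [z|z] := eqVneq (usubmx Z) 0; last by rewrite ltr_pwDl ?AX ?ge0.
rewrite ltr_wpDl ?ge0 // BX //; apply: contra_neq Z0 => ->.
by rewrite z col_mx0.
Qed.

(** Compression affects only the constant term of the pencil; the correction is nonnegative for a
    contraction [F]. *)
Lemma pencil_form_conj l m k (A : mxtuple R g l) (Y : mxtuple R g m)
    (F : 'M[R]_(m, k)) Z :
  pencil_form A (conjtuple F Y) Z =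
  pencil_form A Y (Z *m F^T) + (ip Z Z - ip (Z *m F^T) (Z *m F^T)).
Proof.
rewrite /pencil_form /pencil_apply !ipDr !ip_sumr.
suff -> : \sum_j ip Z (A j *m Z *m conjtuple F Y j) =
  \sum_j ip (Z *m F^T) (A j *m (Z *m F^T) *m Y j) by ring.
by apply: eq_bigr => j _; rewrite /conjtuple !mulmxA ip_mulr.
Qed.

Lemma pencil_form_scale l n (A : mxtuple R g l) (X : mxtuple R g n) s Z :
  pencil_form A (fun j => s *: X j) Z = (1 - s) * ip Z Z + s * pencil_form A X Z.
Proof.
rewrite /pencil_form /pencil_apply !ipDr.
have -> : \sum_j A j *m Z *m (s *: X j) = s *: \sum_j A j *m Z *m X j.
  by rewrite scaler_sumr; apply: eq_bigr => j _; rewrite -scalemxAr.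
by rewrite ipZr; ring.
Qed.

Definition contractive m k (F : 'M[R]_(m, k)) : Prop :=
  forall l (Z : 'M[R]_(l, k)), ip (Z *m F^T) (Z *m F^T) <= ip Z Z.

Lemma enormE n (v : 'cV[R]_n) : enorm v = Num.sqrt (ip v v).
Proof.
by rewrite ipE /enorm big_ord1; congr Num.sqrt; apply: eq_bigr => i _; rewrite expr2.
Qed.

Lemma contractive_contraction m k (F : 'M[R]_(m, k)) :
  contractive F -> Defs.contraction F.
Proof.
move=> cF; rewrite /Defs.contraction /opnorm; apply: ge_sup.
  by exists (enorm (F *m 0)); exists 0 => //=; rewrite enormE ip0r sqrtr0.
move=> _ [v /= v1 <-]; apply: le_trans v1; rewrite !enormE ler_wsqrtr //.
have := cF 1%N v^T; rewrite -trmx_mul.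
have tr (d : nat) (w : 'cV[R]_d) : ip w^T w^T = ip w w.
  by rewrite /ip trmxK mxtrace_mulC.
by rewrite !tr.
Qed.

Lemma pencil_pos_conj l m k (A : mxtuple R g l) (Y : mxtuple R g m)
    (F : 'M[R]_(m, k)) :
  contractive F -> pencil_pos A Y -> pencil_pos A (conjtuple F Y).
Proof.
move=> cF AY Z Z0; rewrite pencil_form_conj.
have [z|z] := eqVneq (Z *m F^T) 0.
  by rewrite z /pencil_form !(ipC 0) !ip0r subr0 add0r ip_gt0.
by rewrite ltr_pwDl ?AY // subr_ge0.
Qed.

(** * Matrices as vectors of a tensor product *)

Lemma sum_mxtens l n (f : 'I_(l * n) -> R) :
  \sum_k f k = \sum_i \sum_j f (mxtens_index (i, j)).
Proof.
rewrite pair_big (reindex (@mxtens_index l n)) /=; last first.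
  by exists (@mxtens_unindex l n) => x _; rewrite (mxtens_indexK, mxtens_unindexK).
by apply: eq_bigr => -[].
Qed.

Definition tens_col l n (Z : 'M[R]_(l, n)) : 'cV[R]_(l * n) :=
  \col_k Z (mxtens_unindex k).1 (mxtens_unindex k).2.

Definition tens_uncol l n (v : 'cV[R]_(l * n)) : 'M[R]_(l, n) :=
  \matrix_(i, j) v (mxtens_index (i, j)) 0.

Lemma tens_uncolK l n : cancel (@tens_uncol l n) (@tens_col l n).
Proof.
by move=> v; apply/colP => k; rewrite !mxE -surjective_pairing mxtens_unindexK.
Qed.

Lemma tens_colD l n (Y Z : 'M[R]_(l, n)) :
  tens_col (Y + Z) = tens_col Y + tens_col Z.
Proof. by apply/colP => k; rewrite !mxE. Qed.

Lemma tens_col_eq0 l n (Z : 'M[R]_(l, n)) : (tens_col Z == 0) = (Z == 0).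
Proof.
apply/eqP/eqP => [z|->]; last by apply/colP => k; rewrite !mxE.
apply/matrixP => i j; have /colP/(_ (mxtens_index (i, j))) := z.
by rewrite !mxE mxtens_indexK.
Qed.

Lemma tens_col_sum l n I (r : seq I) (F : I -> 'M[R]_(l, n)) :
  tens_col (\sum_(i <- r) F i) = \sum_(i <- r) tens_col (F i).
Proof.
apply: (big_morph (@tens_col l n)); first exact: tens_colD.
by apply/eqP; rewrite tens_col_eq0.
Qed.

Lemma tens_col_ip l n (Y Z : 'M[R]_(l, n)) :
  ((tens_col Y)^T *m tens_col Z) 0 0 = ip Y Z.
Proof.
rewrite mxE sum_mxtens ipE exchange_big; apply: eq_bigr => j _; apply: eq_bigr => i _.
by rewrite !mxE mxtens_indexK.
Qed.

Lemma tensmx_mulmx l n (A : 'M[R]_l) (B : 'M[R]_n) (Z : 'M[R]_(l, n)) :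
  tensmx A B *m tens_col Z = tens_col (A *m Z *m B^T).
Proof.
apply/colP => k; case: (mxtens_indexP k) => i j; rewrite mxE [RHS]mxE mxtens_indexK.
rewrite [RHS]mxE sum_mxtens exchange_big; apply: eq_bigr => b _.
rewrite !mxE mulr_suml; apply: eq_bigr => a _.
by rewrite tensmxE mxE mxtens_indexK mulrAC.
Qed.

Lemma posdef_pencil l n (A : mxtuple R g l) (X : mxtuple R g n) :
  symtuples A -> symtuples X -> posdef (pencil A X) <-> pencil_pos A X.
Proof.
move=> As Xs; have pencil_col Z : pencil A X *m tens_col Z = tens_col (pencil_apply A X Z).
  rewrite mulmxDl tensmx_mulmx trmx1 mulmx1 mul1mx tens_colD; congr (_ + _).
  rewrite mulmx_suml tens_col_sum; apply: eq_bigr => j _.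
  by rewrite tensmx_mulmx Xs.
have form Z : ((tens_col Z)^T *m pencil A X *m tens_col Z) 0 0 = pencil_form A X Z.
  by rewrite -mulmxA pencil_col tens_col_ip.
split=> [[_ pos] Z Z0|pos]; first by rewrite -form pos ?tens_col_eq0.
split=> [|v v0].
  rewrite linearD linear_sum /= trmx_tens !trmx1; congr (_ + _).
  by apply: eq_bigr => j _; rewrite trmx_tens As Xs.
by rewrite -(tens_uncolK v) form pos // -tens_col_eq0 tens_uncolK.
Qed.

End Pencils.

(** * Boundary points of matrix convex sets *)

Section MatrixConvex.
Variables (R : realType) (g : nat).
Implicit Types l m n k : nat.

Definition scale_tuple n (s : R) (X : mxtuple R g n) : mxtuple R g n :=
  fun j => s *: X j.

Lemma scale_tupleA n s t (X : mxtuple R g n) :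
  scale_tuple s (scale_tuple t X) = scale_tuple (s * t) X.
Proof. by apply/funext => j; rewrite /scale_tuple scalerA. Qed.

Lemma conj_scale n m s (F : 'M[R]_(n, m)) (X : mxtuple R g n) :
  conjtuple F (scale_tuple s X) = scale_tuple s (conjtuple F X).
Proof.
by apply/funext => j; rewrite /conjtuple /scale_tuple -scalemxAr -scalemxAl.
Qed.

Lemma dsum_scale n m s (X : mxtuple R g n) (Y : mxtuple R g m) :
  dsum (scale_tuple s X) (scale_tuple s Y) = scale_tuple s (dsum X Y).
Proof.
by apply/funext => j; rewrite /dsum /scale_tuple scale_block_mx !scaler0.
Qed.

Lemma symtuples_conj n m (F : 'M[R]_(n, m)) (X : mxtuple R g n) :
  symtuples X -> symtuples (conjtuple F X).
Proof. by move=> Xs j; rewrite /conjtuple !trmx_mul trmxK Xs mulmxA. Qed.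

Lemma symtuples_dsum n m (X : mxtuple R g n) (Y : mxtuple R g m) :
  symtuples X -> symtuples Y -> symtuples (dsum X Y).
Proof. by move=> Xs Ys j; rewrite /dsum tr_block_mx !trmx0 Xs Ys. Qed.

Lemma symtuples_scale n s (X : mxtuple R g n) :
  symtuples X -> symtuples (scale_tuple s X).
Proof. by move=> Xs j; rewrite /scale_tuple linearZ /= Xs. Qed.

Lemma continuous_mxtuple n (c : R -> mxtuple R g n) :
  (forall j a b, continuous (fun s => c s j a b)) -> continuous c.
Proof.
move=> cc s; have cj j : (fun t => c t j) @ s --> c s j.
  move=> A [P HP sP].
  have : \forall t \near s, forall a b, P a b (c t j a b).
    have F (a b : 'I_n) : \forall t \near s, P a b (c t j a b) by apply: cc; exact: HP.
    apply: (@filter_forall _ _ (fun a t => forall b, P a b (c t j a b)) (nbhs s) _).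
    move=> a; exact: (@filter_forall _ _ (fun b t => P a b (c t j a b)) (nbhs s) _ (F a)).
  by apply: filterS => t; exact: sP.
have Fc : Filter (c @ s) by exact: fmap_filter.
apply/(@cvg_sup _ _ _ (c @ s) _ Fc) => j A [B [[V oV <-] Vs BA]].
have : \forall t \near s, V (c t j) by apply: (cj j); exact: open_nbhs_nbhs.
by apply: filterS => t Vt; exact: BA.
Qed.

Lemma continuous_scale_tuple n (X : mxtuple R g n) :
  continuous (fun s => scale_tuple s X).
Proof.
apply: continuous_mxtuple => j a b.
have -> : (fun s : R => scale_tuple s X j a b) = fun s => s * X j a b.
  by apply/funext => s; rewrite mxE.
by move=> s; apply: continuousM => //; exact: cst_continuous.
Qed.

(** This passes positivity on [W] to boundary points, of which only the multiples by [s < 1] are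
    known to lie in [W]. *)
Lemma affine_ge0 (a b : R) : (forall s, 0 <= s < 1 -> 0 <= a + s * b) -> 0 <= a + b.
Proof.
move=> H; have a0 : 0 <= a by have := H 0; rewrite lexx ltr01 mul0r addr0; exact.
rewrite leNgt; apply/negP => neg.
(* At this [s] the value is half of [a + b], hence already negative. *)
pose s := (a - b) / (- 2 * b).
have b0 : 0 < - 2 * b by lra.
have sb : s * (- 2 * b) = a - b by rewrite divfK // gt_eqF.
have s0 : 0 <= s by rewrite divr_ge0 ?ltW //; lra.
have s1 : s < 1 by rewrite ltr_pdivrMr // mul1r; lra.
by have := H s; rewrite s0 s1 => /(_ isT); lra.
Qed.

Variable W : graded R g.
Hypothesis Wsym : graded_set W.
Hypothesis Wbmc : bounded_matrix_convex W.

(** Boundary points are approached along rays instead of by closures: direct sums inherit this form,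
    and so do compressions that stay outside [W]. *)
Definition on_boundary n (X : mxtuple R g n) : Prop :=
  [/\ symtuples X, ~ W X & forall s, 0 <= s < 1 -> W (scale_tuple s X)].

Lemma bmc_contractive m k (F : 'M[R]_(m, k)) (Y : mxtuple R g m) :
  (0 < m)%N -> (0 < k)%N -> contractive F -> W Y -> W (conjtuple F Y).
Proof.
move=> m0 k0 cF WY; apply: (bmc_conj Wbmc) => //; exact: contractive_contraction.
Qed.

Lemma contractive_scalar n (s : R) : s ^+ 2 <= 1 -> contractive (s%:M : 'M[R]_n).
Proof.
move=> s1 l Z; rewrite tr_scalar_mx mul_mx_scalar ipZl ipZr mulrA -expr2.
by rewrite ler_piMl ?ip_ge0.
Qed.

Lemma bmc_scale n s (X : mxtuple R g n) :
  (0 < n)%N -> 0 <= s <= 1 -> W X -> W (scale_tuple s X).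
Proof.
move=> n0 /andP[s0 s1] WX; pose F := (Num.sqrt s)%:M : 'M[R]_n.
have -> : scale_tuple s X = conjtuple F X.
  apply/funext => j; rewrite /conjtuple tr_scalar_mx mul_scalar_mx mul_mx_scalar.
  by rewrite scalerA -expr2 sqr_sqrtr.
by apply: bmc_contractive => //; apply: contractive_scalar; rewrite sqr_sqrtr.
Qed.

Lemma boundary_dsum n m (X : mxtuple R g n) (Y : mxtuple R g m) :
  (0 < n)%N -> (0 < m)%N -> on_boundary X -> on_boundary Y ->
  on_boundary (dsum X Y).
Proof.
move=> n0 m0 [Xs XW Xr] [Ys _ Yr]; split.
- exact: symtuples_dsum.
- pose F := col_mx 1%:M 0 : 'M[R]_(n + m, n).
  move=> WXY; apply: XW.
  have -> : X = conjtuple F (dsum X Y).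
    apply/funext => j; rewrite /conjtuple /dsum tr_col_mx trmx1 trmx0.
    by rewrite mul_row_block !mul1mx !mul0mx !addr0 mul_row_col mulmx1 mulmx0 addr0.
  apply: bmc_contractive => //; first by rewrite addn_gt0 n0.
  move=> l Z; rewrite tr_col_mx trmx1 trmx0 mul_mx_row mulmx1 mulmx0.
  by rewrite ip_row_mx ip0r addr0.
- by move=> s s01; rewrite -dsum_scale; apply: (bmc_dsum Wbmc); auto.
Qed.

Lemma boundary_conj m k (F : 'M[R]_(m, k)) (Y : mxtuple R g m) :
  (0 < m)%N -> (0 < k)%N -> contractive F -> on_boundary Y ->
  ~ W (conjtuple F Y) -> on_boundary (conjtuple F Y).
Proof.
move=> m0 k0 cF [Ys _ Yr] nW; split=> //; first exact: symtuples_conj.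
by move=> s s01; rewrite -conj_scale; apply: bmc_contractive; auto.
Qed.

Lemma bmc_near n (c : R -> mxtuple R g n) s : (0 < n)%N -> continuous c ->
  (forall t, symtuples (c t)) -> W (c s) -> \forall t \near s, W (c t).
Proof.
move=> n0 cc cs Ws; have [U Uo UW] := bmc_open Wbmc n0.
have Us : U (c s) by move: Ws; rewrite UW => -[].
have : \forall t \near s, U (c t) by apply: cc; exact: open_nbhs_nbhs.
by apply: filterS => t Ut; rewrite UW; split=> //; exact: cs.
Qed.

(** The exit time is the supremum of the times spent in [W]. Monotonicity puts all earlier points in
    [W]; openness keeps the point at that time outside. *)
Lemma exit_point n (c : R -> mxtuple R g n) : (0 < n)%N -> continuous c ->
  (forall t, symtuples (c t)) -> W (c 0) -> ~ W (c 1) ->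
  (forall s t, 0 <= s <= t -> t <= 1 -> W (c t) -> W (c s)) ->
  exists s0, [/\ 0 < s0 <= 1, ~ W (c s0) & forall s, 0 <= s < s0 -> W (c s)].
Proof.
move=> n0 cc cs W0 W1 mono; pose E := [set s : R | 0 <= s <= 1 /\ W (c s)].
have E0 : E 0 by split=> //; rewrite lexx ler01.
have Eub : ubound E 1 by move=> s [/andP[]].
have hsE : has_sup E by split; [exists 0|exists 1].
set s0 := sup E.
have s00 : 0 <= s0 by apply: ub_le_sup E0; exists 1; exact: Eub.
have s01 : s0 <= 1 by apply: ge_sup Eub; exists 0.
have below s : 0 <= s < s0 -> W (c s).
  move=> /andP[s_0 ss0]; have [t [/andP[t0 t1] Wt] st] := sup_gt (ex_intro _ 0 E0) ss0.
  by apply: (mono s t) => //; rewrite s_0 ltW.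
have Ws0 : ~ W (c s0).
  move=> Ws0; have s0lt1 : s0 < 1.
    by rewrite lt_neqAle s01 andbT; apply/eqP => s0E; apply: W1; rewrite -s0E.
  have /nbhs_ballP[e e0 He] := bmc_near n0 cc cs Ws0.
  pose t := Num.min 1 (s0 + e / 2).
  have st : s0 < t by rewrite lt_min s0lt1 ltrDl divr_gt0.
  have Wt : W (c t).
    apply: He; rewrite /ball/= ltr_norml.
    have t1 : t <= s0 + e / 2 by rewrite ge_min lexx orbT.
    have e0' : 0 < e by []. apply/andP; split; lra.
  have : t <= s0.
    apply: ub_le_sup; first by exists 1; exact: Eub.
    by split=> //; rewrite ge_min lexx andbT (le_trans s00) ?ltW.
  by rewrite leNgt st.
exists s0; split=> //; rewrite s01 andbT lt_neqAle s00 andbT; apply/eqP => s0E.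
by apply: Ws0; rewrite -s0E.
Qed.

Lemma boundary_on_ray n (Y : mxtuple R g n) : (0 < n)%N -> symtuples Y ->
  ~ W Y -> exists2 t, 0 < t <= 1 & on_boundary (scale_tuple t Y).
Proof.
move=> n0 Ys nW; have [||||| t [t01 Wt Wlt]] := @exit_point n (fun s => scale_tuple s Y) n0.
- exact: continuous_scale_tuple.
- by move=> t; exact: symtuples_scale.
- rewrite (_ : scale_tuple 0 Y = 0); first exact: bmc_0.
  by apply/funext => j; rewrite /scale_tuple scale0r.
- by rewrite (_ : scale_tuple 1 Y = Y) //; apply/funext => j; exact: scale1r.
- move=> s t /andP[s0 st] t1; move=> Wt; have [t0|t0] := eqVneq t 0.
    by rewrite (_ : s = t) //; apply/le_anti; rewrite st t0 s0.
  have tpos : 0 < t by rewrite lt_neqAle eq_sym t0 (le_trans s0).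
  rewrite -(divfK t0 s) -scale_tupleA; apply: bmc_scale => //.
  by rewrite ler_pdivrMr // mul1r st andbT divr_ge0 // ltW.
exists t => //; split=> //; first exact: symtuples_scale.
move=> s /andP[s0 s1]; rewrite scale_tupleA; apply: Wlt.
by case/andP: t01 => t0 _; rewrite gtr_pMl // s1 andbT mulr_ge0 // ltW.
Qed.

End MatrixConvex.

(** * The Effros-Winkler theorem *)

Section EffrosWinkler.
Variables (R : realType) (g : nat).
Variable W : graded R g.
Hypothesis Wsym : graded_set W.
Hypothesis Wbmc : bounded_matrix_convex W.

Section Encoding.
Variable n : nat.
Let index := (option 'I_g * ('I_n * 'I_n))%type.

(** Tuples are flattened to row vectors, to which the separation of convex sets applies; [None]
    indexes the constant coefficient. *)
Definition encode (S : option 'I_g -> 'M[R]_n) : 'rV[R]_#|{: index}| :=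
  \row_k S (enum_val k).1 (enum_val k).2.1 (enum_val k).2.2.

Definition decode (l : 'rV[R]_#|{: index}|) (o : option 'I_g) : 'M[R]_n :=
  \matrix_(a, b) l 0 (enum_rank (o, (a, b))).

Lemma decodeK l : encode (decode l) = l.
Proof. by apply/rowP => k; rewrite !mxE -!surjective_pairing enum_valK. Qed.

Lemma encodeK S : decode (encode S) = S.
Proof. by apply/funext => o; apply/matrixP => a b; rewrite !mxE enum_rankK. Qed.

Lemma encodeD S S' : encode S + encode S' = encode (fun o => S o + S' o).
Proof. by apply/rowP => k; rewrite !mxE. Qed.

Lemma encodeZ a S : a *: encode S = encode (fun o => a *: S o).
Proof. by apply/rowP => k; rewrite !mxE. Qed.

Lemma encode0 S : encode S = 0 -> forall o, S o = 0.
Proof.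
move=> S0 o; apply/matrixP => a b; rewrite mxE.
by have /rowP/(_ (enum_rank (o, (a, b)))) := S0; rewrite !mxE enum_rankK.
Qed.

Lemma dot_encode S S' : dot (encode S) (encode S') = \sum_o ip (S o) (S' o).
Proof.
pose F (t : index) := S t.1 t.2.1 t.2.2 * S' t.1 t.2.1 t.2.2.
transitivity (\sum_t F t).
  rewrite (big_enum_val (A := {: index}) (fun t => F t)).
  by apply: eq_bigr => k _; rewrite !mxE.
rewrite -(pair_big xpredT xpredT (fun o ab => F (o, ab))) /=.
apply: eq_bigr => o _; rewrite ipE exchange_big.
by rewrite -(pair_big xpredT xpredT (fun a b => F (o, (a, b)))).
Qed.

Definition symmetric_rows : set 'rV[R]_#|{: index}| :=
  [set l | forall o, (decode l o)^T = decode l o].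

Lemma closed_symmetric_rows : closed symmetric_rows.
Proof.
rewrite (_ : symmetric_rows = \bigcap_(t : index) [set l : 'rV[R]_#|{: index}| |
    l 0 (enum_rank t) - l 0 (enum_rank (t.1, (t.2.2, t.2.1))) = 0]); last first.
  apply/seteqP; split=> [l ls [ o [a b] ] _ /=|l ls o].
    by have /matrixP/(_ a b) := ls o; rewrite !mxE => ->; rewrite subrr.
  apply/matrixP => a b; rewrite !mxE; apply/eqP; rewrite -subr_eq0.
  by apply/eqP; exact: (ls (o, (b, a))).
apply: closed_bigI => t _; apply: closed_eq_continuous => l.
by apply: continuousB; exact: continuous_coord.
Qed.

End Encoding.

(** Both signs of [t] are available; in [effros_winkler] this forces the kernel of the constant
    coefficient into that of each linear one. *)
Lemma bmc_coordinate (j : 'I_g) : exists2 e : R, 0 < e & forall t, `|t| < e ->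
  W (fun i => if i == j then t%:M else 0 : 'M[R]_1).
Proof.
pose c t : mxtuple R g 1 := fun i => if i == j then t%:M else 0.
have cc : continuous c.
  apply: continuous_mxtuple => i a b; rewrite /c; case: (i == j).
    have -> : (fun s : R => (s%:M : 'M[R]_1) a b) = id.
      by apply/funext => s; rewrite !ord1 mxE eqxx mulr1n.
    by move=> s; exact: cvg_id.
  exact: cst_continuous.
have /nbhs_ballP[e e0 He] : \forall t \near (0 : R), W (c t).
  apply: (bmc_near Wbmc) => //.
    by move=> t i; rewrite /c; case: (i == j); rewrite ?tr_scalar_mx ?trmx0.
  rewrite (_ : c 0 = 0); first exact: (bmc_0 Wbmc).
  by apply/funext => i; rewrite /c; case: (i == j) => //; rewrite raddf0.
exists e => // t te; apply: He.
by rewrite /ball/= sub0r normrN.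
Qed.

Section Cone.
Variable n : nat.

(* For [Y] in [W] these points form a convex cone, because [W] is closed under
   direct sums. *)
Definition cone_point m (F : 'M[R]_(m, n)) (Y : mxtuple R g m)
  (o : option 'I_g) : 'M[R]_n :=
  if o is Some j then F^T *m Y j *m F else F^T *m F.

Lemma cone_point_sym m (F : 'M[R]_(m, n)) (Y : mxtuple R g m) o :
  symtuples Y -> (cone_point F Y o)^T = cone_point F Y o.
Proof.
by move=> Ys; case: o => [j|] /=; rewrite !trmx_mul trmxK ?Ys ?mulmxA.
Qed.

Lemma cone_pointZ m a (F : 'M[R]_(m, n)) (Y : mxtuple R g m) o :
  cone_point (a *: F) Y o = a ^+ 2 *: cone_point F Y o.
Proof.
by case: o => [j|] /=; rewrite [(a *: F)^T]linearZ /= -!scalemxAl -scalemxAr scalerA expr2.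
Qed.

Lemma cone_point_dsum m k (F : 'M[R]_(m, n)) (Y : mxtuple R g m)
    (F' : 'M[R]_(k, n)) (Y' : mxtuple R g k) o :
  cone_point (col_mx F F') (dsum Y Y') o = cone_point F Y o + cone_point F' Y' o.
Proof.
case: o => [j|] /=; rewrite tr_col_mx ?mul_row_block ?mul_row_col //.
by rewrite !mulmx0 addr0 add0r.
Qed.

(** If [(1, X)] were a cone point, [F] would be an isometry and [X = F^T Y F] would lie in [W]. A
    functional separating it from the cone is nonnegative on the cone and at most zero at
    [(1, X)]. *)
Lemma cone_separation (X : mxtuple R g n) : (0 < n)%N -> on_boundary W X ->
  exists (T : 'M[R]_n) (L : mxtuple R g n),
  [/\ T^T = T, symtuples L, (T != 0) || [exists j, L j != 0],
      forall m (F : 'M[R]_(m, n)) Y, (0 < m)%N -> W Y ->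
        0 <= ip T (F^T *m F) + \sum_j ip (L j) (F^T *m Y j *m F) &
      ip T 1%:M + \sum_j ip (L j) (X j) = 0].
Proof.
move=> n0 [Xs XW Xr].
pose S0 (o : option 'I_g) : 'M[R]_n := if o is Some j then X j else 1%:M.
(* The cone is shifted by [- S0], so that the point to be separated is the origin. *)
pose C := [set x | exists m (F : 'M[R]_(m, n)) (Y : mxtuple R g m),
  [/\ (0 < m)%N, W Y & x = encode (fun o => cone_point F Y o - S0 o)]].
have Cconv : convex_subset C.
  move=> _ _ t /andP[t0 t1] [m [F [Y [m0 WY ->]]]] [k [F' [Y' [k0 WY' ->]]]].
  exists (m + k)%N, (col_mx (Num.sqrt t *: F) (Num.sqrt (1 - t) *: F')), (dsum Y Y').
  split; [by rewrite addn_gt0 m0|exact: (bmc_dsum Wbmc)|].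
  rewrite !encodeZ encodeD; congr encode; apply/funext => o.
  rewrite cone_point_dsum !cone_pointZ !sqr_sqrtr ?subr_ge0 // !scalerBr.
  by rewrite addrACA -opprD -scalerDl subrKC scale1r.
have C0 : ~ C 0.
  move=> [m [F [Y [m0 WY /esym/encode0 E]]]]; apply: XW.
  have FF : F^T *m F = 1%:M by apply/eqP; rewrite -subr_eq0; apply/eqP; exact: (E None).
  have -> : X = conjtuple F Y.
    apply/funext => j; apply/esym/eqP; rewrite -subr_eq0; apply/eqP.
    exact: (E (Some j)).
  apply: (bmc_contractive Wbmc) => // l Z.
  by rewrite ip_mulr trmxK -mulmxA FF mulmx1.
have Cn0 : C !=set0.
  exists (encode (fun o => cone_point (0 : 'M[R]_(1, n)) 0 o - S0 o)).
  by exists 1%N, 0, 0; split=> //; exact: (bmc_0 Wbmc).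
have S0sym o : (S0 o)^T = S0 o by case: o => [j|] /=; rewrite ?Xs ?trmx1.
have [||l [ls l0 lpos]] :=
    weak_separation Cconv Cn0 C0 (@closed_symmetric_rows n).
- move=> a u us o; rewrite -[u]decodeK encodeZ encodeK linearZ /=.
  by rewrite us.
- move=> _ [m [F [Y [m0 WY ->]]]] o; rewrite encodeK linearB /= S0sym.
  by rewrite cone_point_sym //; exact: Wsym WY.
pose L := decode l.
have Phi m (F : 'M[R]_(m, n)) (Y : mxtuple R g m) : (0 < m)%N -> W Y ->
    \sum_o ip (L o) (S0 o) <= \sum_o ip (L o) (cone_point F Y o).
  move=> m0 WY; rewrite -subr_ge0 -sumrB.
  have /lpos : C (encode (fun o => cone_point F Y o - S0 o)) by exists m, F, Y.
  rewrite -[l]decodeK dot_encode; congr (_ <= _); apply: eq_bigr => o _.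
  by rewrite ipDr -scaleN1r ipZr mulN1r.
set k := \sum_o _ in Phi.
have k_le0 : k <= 0.
  have := Phi 1%N 0 0 isT (bmc_0 Wbmc (ltn0Sn 0)); rewrite [leRHS]big1 // => -[j|] _ /=;
    by rewrite !mulmx0 ip0r.
have Phi_ge0 m (F : 'M[R]_(m, n)) (Y : mxtuple R g m) : (0 < m)%N -> W Y ->
    0 <= \sum_o ip (L o) (cone_point F Y o).
  move=> m0 WY; rewrite leNgt; set p := \sum_o _; apply/negP => p0.
  (* Scaling the cone point by this factor would bring its value to [k - 1], below the lower bound
     [k]. *)
  have c0 : 0 <= (k - 1) / p by rewrite mulr_le0 ?invr_le0 ?ltW //; lra.
  have := Phi m (Num.sqrt ((k - 1) / p) *: F) Y m0 WY.
  have -> : \sum_o ip (L o) (cone_point (Num.sqrt ((k - 1) / p) *: F) Y o) = k - 1.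
    rewrite -[RHS](divfK (negbT (lt_eqF p0))) /p mulr_sumr; apply: eq_bigr => o _.
    by rewrite cone_pointZ sqr_sqrtr // ipZr.
  lra.
have sumo (f : option 'I_g -> R) : \sum_o f o = f None + \sum_j f (Some j).
  rewrite (bigD1 None) //=; congr (_ + _).
  rewrite (reindex_omap Some id) /= => [|[]//].
  by apply: eq_bigl => j; rewrite eqxx.
have kE : k = ip (L None) 1%:M + \sum_j ip (L (Some j)) (X j) by rewrite /k sumo.
exists (L None), (fun j => L (Some j)); split.
- exact: ls.
- by move=> j; exact: ls.
- apply/negPn/negP => /norP[/negPn/eqP T0 /existsPn L0]; move/eqP: l0; apply.
  rewrite -[l]decodeK; apply/rowP => i; rewrite mxE [RHS]mxE -/L.
  by case: (enum_val i).1 => [j|]; rewrite ?T0 ?(eqP (negPn (L0 j))) mxE.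
- by move=> m F Y m0 WY; have := Phi_ge0 m F Y m0 WY; rewrite sumo.
(* For [s < 1] the pair [(1, s X)] is a cone point, with [F] the identity; now let [s] tend to 1. *)
rewrite -kE; apply/le_anti; rewrite k_le0 /= kE; apply: affine_ge0 => s s01.
have := Phi_ge0 n 1%:M (scale_tuple s X) n0 (Xr s s01); rewrite sumo /= trmx1 mulmx1.
rewrite mulr_sumr; congr (_ <= _ + _); apply: eq_bigr => j _.
by rewrite mul1mx mulmx1 /scale_tuple ipZr.
Qed.

End Cone.

End EffrosWinkler.

Section EffrosWinklerTheorem.
Variables (R : realType) (g : nat).
Variable W : graded R g.
Hypothesis Wsym : graded_set W.
Hypothesis Wbmc : bounded_matrix_convex W.

(** As [W] is open, the form is nonnegative also slightly beyond [Y] on its ray; it is affine along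
    the ray and positive at the origin, hence positive at [Y]. *)
Lemma bmc_pencil_pos l (A : mxtuple R g l) n (Y : mxtuple R g n) : (0 < n)%N ->
  (forall X : mxtuple R g n, W X -> forall Z, 0 <= pencil_form A X Z) ->
  W Y -> pencil_pos A Y.
Proof.
move=> n0 pos WY Z Z0; have Ys := Wsym n0 WY.
have /nbhs_ballP[e /= e0 He] : \forall t \near (1 : R), W (scale_tuple t Y).
  apply: (@bmc_near R g W Wbmc n (fun t => scale_tuple t Y) 1 n0).
    exact: continuous_scale_tuple.
    by move=> t; exact: symtuples_scale.
  by rewrite (_ : scale_tuple 1 Y = Y) //; apply/funext => j; exact: scale1r.
have /pos/(_ Z) : W (scale_tuple (1 + e / 2) Y).
  by apply: He; rewrite /ball/= opprD addNKr normrN gtr0_norm ?divr_gt0 //; lra.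
rewrite pencil_form_scale; have := ip_gt0 Z0.
set a := ip Z Z; set b := pencil_form A Y Z; clearbody a b; nra.
Qed.

(** For the functional [(T, L)] of [cone_separation], [T] is positive semidefinite and its kernel
    lies in that of every [L j]. Hence [T = Q^T Q] and [L j = Q^T A_j Q]: the functional becomes a
    monic pencil [A], and its vanishing at [(1, X)] makes [Q] a kernel vector. *)
Lemma effros_winkler n (X : mxtuple R g n) : (0 < n)%N -> on_boundary W X ->
  exists r (A : mxtuple R g r) (Z : 'M[R]_(r, n)),
  [/\ symtuples A, Z != 0,
      forall m (Y : mxtuple R g m), (0 < m)%N -> W Y -> pencil_pos A Y &
      pencil_apply A X Z = 0].
Proof.
move=> n0 bX; have [T [L [Ts Ls nz Phi k0]]] := cone_separation Wsym Wbmc n0 bX.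
have rowT (u : 'rV[R]_n) (S : 'M[R]_n) : S^T = S -> ip S (u^T *m u) = ip u (u *m S).
  by move=> Ss; rewrite ip_mull trmxK ipC.
have Tpos u : 0 <= qform T u.
  have := Phi 1%N u 0 isT (bmc_0 Wbmc (ltn0Sn 0)); rewrite rowT // qformE big1 ?addr0 //.
  by move=> j _; rewrite mulmx0 mul0mx ip0r.
have ker (u : 'rV[R]_n) j : u *m T = 0 -> u *m L j = 0.
  move=> uT; have [e e0 He] := bmc_coordinate Wbmc j.
  have dom (v : 'rV[R]_n) t : `|t| < e -> 0 <= ip v (v *m T) + t * ip v (v *m L j).
    move=> te; have := Phi 1%N v _ isT (He t te); rewrite rowT // (bigD1 j) //= eqxx.
    rewrite big1 => [|i /negPf ->]; last by rewrite mulmx0 mul0mx ip0r.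
    by rewrite addr0 mul_mx_scalar -scalemxAl ipZr rowT.
  have e2 : `|e / 2| < e by rewrite gtr0_norm ?divr_gt0 //; lra.
  have e2' : `|- (e / 2)| < e by rewrite normrN.
  (* Using both signs, the form of [L j] vanishes at [u]; perturbing [u] in the direction [w] then
     gives [w = 0]. *)
  have uLu : ip u (u *m L j) = 0.
    have := dom u _ e2; have := dom u _ e2'; rewrite uT ip0r; nra.
  set w := u *m L j; apply/eqP; rewrite -ip_eq0; apply/eqP.
  suff : e * ip w w = 0 by move=> /eqP; rewrite mulf_eq0 gt_eqF //= => /eqP.
  apply: (@quad_ge0_lin _ _ (ip w (w *m T) + e / 2 * ip w (w *m L j))) => s.
  have := dom (u + s *: w) _ e2; rewrite !mulmxDl uT add0r -/w -!scalemxAl.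
  rewrite !(ipDl u) (ipDr u w) !(ipDr (s *: w)) uLu !ipZl !ipZr.
  have -> : ip u (w *m T) = 0 by rewrite ip_mulr Ts uT ipC ip0r.
  have -> : ip u (w *m L j) = ip w w by rewrite ip_mulr Ls.
  by congr (_ <= _); field.
have [r [Q [Q' [TQ QQ']]]] := psd_factor Ts Tpos.
(* The rows of the transpose of [1 - Q' Q] are annihilated by [T], because [Q Q' = 1]. *)
have LQ j : L j *m (Q' *m Q) = L j.
  apply/eqP; rewrite -subr_eq0 -{2}[L j]mulmx1 -mulmxBr -trmx_eq0; apply/eqP.
  rewrite trmx_mul Ls; apply/row_matrixP => i; rewrite row_mul row0 ker //.
  rewrite -row_mul TQ mulmxA -trmx_mul mulmxBr mulmx1 mulmxA QQ' mul1mx subrr.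
  by rewrite trmx0 mul0mx row0.
pose A j := Q'^T *m L j *m Q'.
have As : symtuples A by move=> j; rewrite /A !trmx_mul trmxK Ls mulmxA.
have QAQ j : Q^T *m A j *m Q = L j.
  rewrite /A -!mulmxA LQ mulmxA -trmx_mul.
  by rewrite -[in LHS](Ls j) -trmx_mul LQ Ls.
have form m (Y : mxtuple R g m) Z : pencil_form A Y Z =
    ip T ((Z^T *m Q'^T)^T *m (Z^T *m Q'^T)) +
    \sum_j ip (L j) ((Z^T *m Q'^T)^T *m Y j *m (Z^T *m Q'^T)).
  rewrite /pencil_form /pencil_apply ipDr ip_sumr; congr (_ + _).
    rewrite ip_mulr !trmx_mul !trmxK TQ -!mulmxA [Q *m _]mulmxA QQ' mul1mx ipC.
    by rewrite ip_mull trmxK mulmxA QQ' mul1mx.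
  apply: eq_bigr => j _; rewrite [RHS]ip_mulr !trmx_mul !trmxK.
  rewrite -(mulmxA (A j)) -(mulmxA Q') [LHS]ip_mull [RHS]ip_mull As.
  by rewrite /A !mulmxA.
have pos m (Y : mxtuple R g m) Z : (0 < m)%N -> W Y -> 0 <= pencil_form A Y Z.
  by move=> m0 WY; rewrite form; exact: Phi.
have [Xs _ Xr] := bX.
exists r, A, Q; split=> //.
- apply: contraTneq nz => Q0; rewrite negb_or negbK TQ Q0 mulmx0 eqxx /=.
  by apply/existsPn => j; rewrite negbK -QAQ Q0 mulmx0.
- by move=> m Y m0; apply: bmc_pencil_pos => // X' WX' Z; exact: pos.
apply: pencil_form_ge0_ker => // [Z|].
  have := @affine_ge0 R (ip Z Z) (pencil_form A X Z - ip Z Z).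
  rewrite subrKC; apply => s s01; have := pos n _ Z n0 (Xr s s01).
  by rewrite pencil_form_scale; congr (_ <= _); ring.
rewrite -k0 /pencil_form /pencil_apply ipDr ip_sumr; congr (_ + _).
  by rewrite TQ -[Q in LHS]mulmx1 ip_mull mulmx1.
by apply: eq_bigr => j _; rewrite ip_mull trmx_mul As QAQ.
Qed.

End EffrosWinklerTheorem.

(** * Words and polynomials *)

Section Words.
Variables (R : realType) (g : nat).

Lemma weval_rcons n (X : mxtuple R g n) w j :
  weval (rcons w j) X = weval w X *m X j.
Proof. by rewrite /weval -cats1 big_cat big_seq1. Qed.

Lemma trmx_weval n (X : mxtuple R g n) w :
  symtuples X -> (weval w X)^T = weval (rev w) X.
Proof.
move=> Xs; elim: w => [|j w IH]; first by rewrite /weval !big_nil trmx1.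
by rewrite rev_cons weval_rcons -IH /weval big_cons trmx_mul Xs.
Qed.

Lemma weval_dsum n m (X : mxtuple R g n) (Y : mxtuple R g m) w :
  weval w (dsum X Y) = block_mx (weval w X) 0 0 (weval w Y).
Proof.
elim: w => [|j w IH]; first by rewrite /weval !big_nil -scalar_mx_block.
rewrite /weval !big_cons -/(weval _ _) IH /dsum [LHS]mulmx_block.
by rewrite !mulmx0 !mul0mx !addr0 !add0r.
Qed.

Definition poly_apply d n (p : ncpoly R g d) (X : mxtuple R g n)
    (V : 'M[R]_(d, n)) : 'M[R]_(d, n) :=
  \sum_(w <- finsupp p) p w *m V *m (weval w X)^T.

Lemma nceval_tens_col d n (p : ncpoly R g d) (X : mxtuple R g n) V :
  nceval p X *m tens_col V = tens_col (poly_apply p X V).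
Proof.
by rewrite mulmx_suml tens_col_sum; apply: eq_bigr => w _; exact: tensmx_mulmx.
Qed.

Lemma poly_apply_unit d n (p : ncpoly R g d) (X : mxtuple R g n) V :
  nceval p X \in unitmx -> poly_apply p X V = 0 -> V = 0.
Proof.
move=> u /eqP; rewrite -tens_col_eq0 -nceval_tens_col => /eqP pV0.
by apply/eqP; rewrite -tens_col_eq0 -(mulKmx u (tens_col V)) pV0 mulmx0.
Qed.

Lemma poly_apply_nonunit d n (p : ncpoly R g d) (X : mxtuple R g n) :
  nceval p X \notin unitmx -> exists2 V, V != 0 & poly_apply p X V = 0.
Proof.
rewrite -unitmx_tr -row_free_unit -kermx_eq0 => /rowV0Pn[v /sub_kermxP vp v0].
exists (tens_uncol v^T).
  by rewrite -tens_col_eq0 tens_uncolK trmx_eq0.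
apply/eqP; rewrite -tens_col_eq0 -nceval_tens_col tens_uncolK -trmx_eq0.
by rewrite trmx_mul trmxK vp.
Qed.

Lemma poly_apply_dsum d n m (p : ncpoly R g d) (X : mxtuple R g n)
    (Y : mxtuple R g m) V V' :
  poly_apply p (dsum X Y) (row_mx V V') = row_mx (poly_apply p X V) (poly_apply p Y V').
Proof.
rewrite /poly_apply; elim/big_ind3: _ => [|? ? ? ? ? ? -> ->|w _].
- by rewrite row_mx0.
- by rewrite add_row_mx.
rewrite weval_dsum tr_block_mx !trmx0 mul_mx_row mul_row_block.
by rewrite !mulmx0 addr0 add0r.
Qed.

Lemma poly_apply0 d n (p : ncpoly R g d) (X : mxtuple R g n) : poly_apply p X 0 = 0.
Proof. by rewrite /poly_apply big1 // => w _; rewrite mulmx0 mul0mx. Qed.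

Lemma nonunit_dsuml d n m (p : ncpoly R g d) (X : mxtuple R g n)
    (Y : mxtuple R g m) :
  nceval p X \notin unitmx -> nceval p (dsum X Y) \notin unitmx.
Proof.
move=> /poly_apply_nonunit[V V0 pV]; apply: contra V0 => u.
have : row_mx V (0 : 'M[R]_(d, m)) = 0.
  by apply: (poly_apply_unit u); rewrite poly_apply_dsum pV poly_apply0 row_mx0.
by move=> /eqP; rewrite row_mx_eq0 => /andP[].
Qed.

Lemma nonunit_dsumr d n m (p : ncpoly R g d) (X : mxtuple R g n)
    (Y : mxtuple R g m) :
  nceval p Y \notin unitmx -> nceval p (dsum X Y) \notin unitmx.
Proof.
move=> /poly_apply_nonunit[V V0 pV]; apply: contra V0 => u.
have : row_mx (0 : 'M[R]_(d, n)) V = 0.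
  by apply: (poly_apply_unit u); rewrite poly_apply_dsum pV poly_apply0 row_mx0.
by move=> /eqP; rewrite row_mx_eq0 => /andP[].
Qed.

End Words.

(** * Orbits of vectors under words *)

Section Orbits.
Variables (R : realType) (g : nat) (I : finType) (d : I -> nat).

(* Vectors are rows, on which words act from the right: for symmetric tuples
   [row a (V i) *m weval w X] is the transpose of [weval (rev w) X] applied to
   the [a]-th component of [V i]. *)
Definition row_family n := forall i, 'M[R]_(d i, n).

Definition orbit_index k := (k.-bseq 'I_g * {i : I & 'I_(d i)})%type.

Definition orbit_row n (X : mxtuple R g n) (V : row_family n) (w : seq 'I_g)
  (ia : {i : I & 'I_(d i)}) : 'rV[R]_n := row (tagged ia) (V (tag ia)) *m weval w X.

(** The rows are enumerated independently of [X] and [V], so a linear relation between orbit vectors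
    is a left multiplier annihilating this matrix and can be compared across points. *)
Definition orbit_mx k n (X : mxtuple R g n) (V : row_family n) :
    'M[R]_(#|{: orbit_index k}|, n) :=
  \matrix_(e < #|{: orbit_index k}|) orbit_row X V (enum_val e).1 (enum_val e).2.

Definition row_family_dsum n m (V : row_family n) (V' : row_family m) :
  row_family (n + m) := fun i => row_mx (V i) (V' i).

Lemma orbit_mx_dsum k n m (X : mxtuple R g n) (Y : mxtuple R g m) V V' :
  orbit_mx k (dsum X Y) (row_family_dsum V V') = row_mx (orbit_mx k X V) (orbit_mx k Y V').
Proof.
apply/row_matrixP => e; rewrite row_row_mx !rowK /orbit_row /row_family_dsum.
by rewrite row_row_mx weval_dsum mul_row_block !mulmx0 addr0 add0r.
Qed.

Lemma bseq_exists k (w : seq 'I_g) : (size w <= k)%N ->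
  exists s : k.-bseq 'I_g, s = w :> seq _.
Proof. by move=> wk; exists (Bseq wk). Qed.

Lemma orbit_row_sub k n (X : mxtuple R g n) V w ia :
  (size w <= k)%N -> (orbit_row X V w ia <= orbit_mx k X V)%MS.
Proof.
move=> /bseq_exists[s <-]; rewrite (eq_row_sub (enum_rank (s, ia))) //.
by rewrite rowK enum_rankK.
Qed.

(** Multiplication by [X j] appends a letter, which selects rows of the longer orbit matrix. One [S]
    serves all points, so relations can be carried from one to another. *)
Lemma orbit_mx_shift k j : exists S : 'M[R]_(#|{: orbit_index k}|, #|{: orbit_index k.+1}|),
  forall n (X : mxtuple R g n) V, orbit_mx k X V *m X j = S *m orbit_mx k.+1 X V.
Proof.
have wk (s : k.-bseq 'I_g) : (size (rcons s j) <= k.+1)%N.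
  by rewrite size_rcons ltnS size_bseq.
pose f (e : 'I_#|{: orbit_index k}|) : 'I_#|{: orbit_index k.+1}| :=
  enum_rank (Bseq (wk (enum_val e).1), (enum_val e).2).
exists (rowsub f 1%:M) => n X V; rewrite -rowsubE; apply/row_matrixP => e.
rewrite row_mul row_rowsub !rowK enum_rankK /= /orbit_row.
by rewrite weval_rcons mulmxA.
Qed.

Lemma orbit_mx_widen k : exists S : 'M[R]_(#|{: orbit_index k}|, #|{: orbit_index k.+1}|),
  forall n (X : mxtuple R g n) V, orbit_mx k X V = S *m orbit_mx k.+1 X V.
Proof.
have wk (s : k.-bseq 'I_g) : (size s <= k.+1)%N by rewrite leqW // size_bseq.
pose f (e : 'I_#|{: orbit_index k}|) : 'I_#|{: orbit_index k.+1}| :=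
  enum_rank (Bseq (wk (enum_val e).1), (enum_val e).2).
exists (rowsub f 1%:M) => n X V; rewrite -rowsubE; apply/row_matrixP => e.
by rewrite row_rowsub !rowK enum_rankK.
Qed.

End Orbits.

(** * Ranks and linear relations *)

(** The factorization of [b] says that all relations between rows of [a] hold for [b]; if the rank
    does not drop, [b] satisfies no others. *)
Lemma mulmx_factor_rank (F : fieldType) m n k (a : 'M[F]_(m, n)) (b : 'M[F]_(m, k)) :
  (exists D, b = a *m D) -> (\rank a <= \rank b)%N -> exists E, a = b *m E.
Proof.
move=> [D bE] rab; have sub : (b^T <= a^T)%MS by rewrite bE trmx_mul submxMl.
have : (a^T <= b^T)%MS.
  rewrite -(mxrank_leqif_sup sub).2 eqn_leq !mxrank_tr rab andbT.
  by rewrite bE mxrankM_maxl.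
by move=> /submxP[E aE]; exists E^T; rewrite -[a]trmxK aE trmx_mul trmxK.
Qed.

Lemma row_mx_factor_rank (F : fieldType) m n k (a : 'M[F]_(m, n)) (b : 'M[F]_(m, k)) :
  (\rank (row_mx a b) <= \rank a)%N -> exists D, b = a *m D.
Proof.
move=> rab; have [|E ab] := mulmx_factor_rank _ rab.
  by exists (col_mx 1%:M 0); rewrite mul_row_col mulmx1 mulmx0 addr0.
by exists (rsubmx E); rewrite mulmx_rsub -ab row_mxKr.
Qed.

Lemma mulmx_row_mx_rank (F : fieldType) m n k (a : 'M[F]_(m, n)) (b : 'M[F]_(m, k)) :
  (\rank b <= \rank (row_mx a b))%N.
Proof.
have {1}-> : b = row_mx a b *m col_mx 0 1%:M by rewrite mul_row_col mulmx0 mulmx1 add0r.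
exact: mxrankM_maxl.
Qed.

Lemma exists_max_nat (P : nat -> Prop) b :
  (exists k, P k) -> (forall k, P k -> (k <= b)%N) ->
  exists2 k, P k & forall k', P k' -> (k' <= k)%N.
Proof.
move=> [k0 Pk0] Pb.
have ex : exists k, `[< P k >] by exists k0; exact/asboolP.
have ub k : `[< P k >] -> (k <= b)%N by move/asboolP; exact: Pb.
by case: (ex_maxnP ex ub) => k /asboolP Pk max; exists k => // k' /asboolP; exact: max.
Qed.

(** * Compression of boundary points *)

Section Shrinking.
Variables (R : realType) (n : nat) (P : 'M[R]_n).
Hypotheses (Psym : P^T = P) (Pidem : P *m P = P).

Definition shrink (s : R) : 'M[R]_n := P + s *: (1%:M - P).

Lemma trmx_shrink s : (shrink s)^T = shrink s.
Proof. by rewrite /shrink linearD linearZ linearB /= trmx1 Psym. Qed.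

Lemma shrink1 : shrink 1 = 1%:M.
Proof. by rewrite /shrink scale1r subrKC. Qed.

Lemma shrink0 : shrink 0 = P.
Proof. by rewrite /shrink scale0r addr0. Qed.

Lemma shrinkM s t : shrink s *m shrink t = shrink (s * t).
Proof.
rewrite /shrink mulmxDl !mulmxDr -!scalemxAl -!scalemxAr !mulmxBl !mulmxBr.
rewrite !mulmx1 !mul1mx Pidem subrr !scaler0 addr0 add0r subr0 scalerA.
by [].
Qed.

Lemma mulmx_shrink k (Z : 'M[R]_(k, n)) s : Z *m P = Z -> Z *m shrink s = Z.
Proof.
by move=> ZP; rewrite /shrink mulmxDr ZP -scalemxAr mulmxBr mulmx1 ZP subrr scaler0 addr0.
Qed.

Lemma contractive_shrink s : 0 <= s <= 1 -> contractive (shrink s).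
Proof.
move=> /andP[s0 s1] k Z; rewrite trmx_shrink.
have ss : s ^+ 2 <= 1 by rewrite expr_le1.
(* The two parts are orthogonal, and only the second is scaled. *)
set A := Z *m P; set B := Z *m (1%:M - P).
have ABE : Z = A + B by rewrite -mulmxDr subrKC mulmx1.
have AB : ip A B = 0.
  rewrite /A /B ip_mulr linearB /= trmx1 Psym -mulmxA mulmxBr mulmx1 Pidem subrr.
  by rewrite mulmx0 ipC ip0r.
have -> : Z *m shrink s = A + s *: B by rewrite /shrink mulmxDr -scalemxAr.
rewrite ABE !(ipDl A) !(ipDr A) !(ipDr (s *: B)) !(ipDr B).
rewrite !ipZl !ipZr (ipC B) AB; have := ip_ge0 B.
set x := ip A A; set y := ip B B; rewrite expr2 in ss; clearbody x y; nra.
Qed.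

Lemma continuous_shrink_conj g (X : mxtuple R g n) :
  continuous (fun s => conjtuple (shrink s) X).
Proof.
apply: continuous_mxtuple => j a b.
have [Q QE] : exists Q, Q = 1%:M - P by exists (1%:M - P).
have -> : (fun s => conjtuple (shrink s) X j a b) =
    fun s => (P *m X j *m P) a b + s * (P *m X j *m Q + Q *m X j *m P) a b +
      s * s * (Q *m X j *m Q) a b.
  apply/funext => s; rewrite /conjtuple trmx_shrink /shrink -QE.
  have -> : (P + s *: Q) *m X j *m (P + s *: Q) = P *m X j *m P +
      s *: (P *m X j *m Q + Q *m X j *m P) + (s * s) *: (Q *m X j *m Q).
    rewrite !mulmxDl !mulmxDr -!scalemxAl -!scalemxAr !scalerA scalerDr.
    by rewrite !addrA.
  move: (P *m X j *m P) (P *m X j *m Q + Q *m X j *m P) (Q *m X j *m Q) => A B C.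
  by rewrite !mxE.
move=> s; apply: cvgD; [apply: cvgD|].
- exact: cvg_cst.
- by apply: cvgM; [exact: cvg_id|exact: cvg_cst].
- by apply: cvgM; [apply: cvgM; exact: cvg_id|exact: cvg_cst].
Qed.

Lemma conj_shrink g (X : mxtuple R g n) s t :
  conjtuple (shrink s) (conjtuple (shrink t) X) = conjtuple (shrink (s * t)) X.
Proof.
apply/funext => j; rewrite /conjtuple !trmx_shrink !mulmxA shrinkM.
by rewrite -!mulmxA shrinkM (mulrC t).
Qed.

End Shrinking.

Section MainStep.
Variables (R : realType) (g : nat).
Variable W : graded R g.
Hypothesis Wsym : graded_set W.
Hypothesis Wbmc : bounded_matrix_convex W.
Variables (I : finType) (d : I -> nat) (p : forall i, ncpoly R g (d i)).

(* What is used of the semialgebraic description of [W]: whenever a subset [T]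
   of [W] accumulates at a point outside [W], one of the polynomials becomes
   singular there without being singular on all of [T]. *)
Definition detects_exit : Prop := forall n (T : set (mxtuple R g n)) X,
  (0 < n)%N -> T `<=` @W n -> symtuples X -> ~ W X -> closure T X ->
  exists i Y, [/\ T Y, nceval (p i) Y \in unitmx & nceval (p i) X \notin unitmx].

Hypothesis exitW : detects_exit.

Definition max_degree : nat := \max_i \max_(w <- finsupp (p i)) size w.

Lemma size_max_degree i w : w \in finsupp (p i) -> (size w <= max_degree)%N.
Proof.
move=> wp; apply: leq_trans (leq_bigmax i).
exact: leq_bigmax_seq.
Qed.

(** [V i] may be zero, and must be when [nceval (p i) X] is invertible. *)
Definition kernel_pair n (X : mxtuple R g n) (V : row_family R d n) : Prop :=
  forall i, poly_apply (p i) X (V i) = 0.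

Lemma kernel_pair_dsum n m (X : mxtuple R g n) (Y : mxtuple R g m) V V' :
  kernel_pair X V -> kernel_pair Y V' ->
  kernel_pair (dsum X Y) (row_family_dsum V V').
Proof.
by move=> XV YV i; rewrite /row_family_dsum poly_apply_dsum XV YV row_mx0.
Qed.

(** As [F] fixes the vectors [v w(X)] for words up to the degree, induction on [w] shows that
    compression by [F] does not change them, nor therefore [p i (X) V i]. *)
Lemma kernel_pair_conj n (X : mxtuple R g n) V F :
  symtuples X -> F^T = F -> orbit_mx max_degree X V *m F = orbit_mx max_degree X V ->
  kernel_pair X V -> kernel_pair (conjtuple F X) V.
Proof.
move=> Xs Fs orbF XV i.
have fix_row w ia : (size w <= max_degree)%N ->
    orbit_row X V w ia *m F = orbit_row X V w ia.
  by move=> /orbit_row_sub-/(_ _ _ _ _ X V ia)/submxP[D ->]; rewrite -mulmxA orbF.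
have same_row w ia : (size w <= max_degree)%N ->
    orbit_row (conjtuple F X) V w ia = orbit_row X V w ia.
  elim/last_ind: w => [|w j IH]; first by rewrite /orbit_row /weval !big_nil.
  rewrite size_rcons => wk; have wk' := ltnW wk.
  have rconsE Y : orbit_row Y V (rcons w j) ia = orbit_row Y V w ia *m Y j.
    by rewrite /orbit_row weval_rcons mulmxA.
  rewrite !rconsE IH // /conjtuple Fs !mulmxA fix_row // -rconsE fix_row //.
  by rewrite size_rcons.
rewrite -[RHS](XV i) /poly_apply; apply: eq_big_seq => w wp.
have wk : (size (rev w) <= max_degree)%N by rewrite size_rev (@size_max_degree i).
rewrite !trmx_weval //; last exact: symtuples_conj.
rewrite -!mulmxA; congr (_ *m _); apply/row_matrixP => a; rewrite !row_mul.
exact: (same_row _ (existT _ i a) wk).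
Qed.

(** Otherwise the path from [P X P] to [X] leaves [W] at a point where some [p i], invertible
    earlier on the path, is singular. Then [V i] is nonzero, yet it lies in the kernel of [p i] all
    along the path. *)
Lemma boundary_compression n (X : mxtuple R g n) V (P : 'M[R]_n) :
  (0 < n)%N -> on_boundary W X -> kernel_pair X V ->
  P^T = P -> P *m P = P -> orbit_mx max_degree X V *m P = orbit_mx max_degree X V ->
  (forall s i, 0 <= s <= 1 -> on_boundary W (conjtuple (shrink P s) X) ->
     nceval (p i) (conjtuple (shrink P s) X) \notin unitmx -> V i != 0) ->
  on_boundary W (conjtuple P X).
Proof.
move=> n0 bX XV Ps Pi orbP Vn0; have [Xs XW Xr] := bX.
have cP : contractive P by rewrite -(shrink0 P); apply: contractive_shrink => //; lra.
apply: boundary_conj => // WP.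
have c1 : conjtuple (shrink P 1) X = X.
  by apply/funext => j; rewrite /conjtuple shrink1 trmx1 mul1mx mulmx1.
have [|||||s0 [s01 Ws0 below]] :=
    @exit_point R g W Wbmc n (fun s => conjtuple (shrink P s) X) n0.
- exact: continuous_shrink_conj.
- by move=> t; exact: symtuples_conj.
- by rewrite shrink0.
- by rewrite c1.
(* The point at time [s] is the compression by [shrink P (s / t)] of the point at time [t]. *)
- move=> s t /andP[s0 st] t1 Wt; have [t0|t0] := eqVneq t 0.
    by rewrite (_ : s = t) //; apply/le_anti; rewrite st t0 s0.
  have tpos : 0 < t by rewrite lt_neqAle eq_sym t0 (le_trans s0).
  rewrite -(divfK t0 s) -conj_shrink //; apply: (bmc_contractive Wbmc) => //.
  apply: contractive_shrink => //.
  by rewrite ler_pdivrMr // mul1r st andbT divr_ge0 // ltW.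
have /andP[s0pos s0le1] := s01.
pose T := [set Y | exists2 s, 0 <= s < s0 & Y = conjtuple (shrink P s) X].
have clT : closure T (conjtuple (shrink P s0) X).
  move=> B /(continuous_shrink_conj Ps)/nbhs_ballP[e /= e0 He].
  pose s := Num.max 0 (s0 - e / 2).
  exists (conjtuple (shrink P s) X); split.
    by exists s => //; rewrite le_max lexx /= gt_max s0pos /= gtrBl divr_gt0.
  apply: He; rewrite /ball/= /s; case: (leP 0 (s0 - e / 2)) => h.
    by rewrite opprB addrC subrK gtr0_norm ?divr_gt0 //; lra.
  by rewrite subr0 gtr0_norm //; lra.
have [|||i [Y [[s ss0 ->] u nu]]] := exitW n0 _ _ _ clT.
- by move=> Y [s ss0 ->]; exact: below.
- exact: symtuples_conj.
- exact: Ws0.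
have : V i != 0.
  apply: Vn0 nu; first by rewrite ltW.
  apply: boundary_conj => //; apply: contractive_shrink => //.
  by rewrite s0le1 ltW.
move/eqP; apply; apply: (poly_apply_unit u); apply: kernel_pair_conj => //.
  exact: trmx_shrink.
exact: mulmx_shrink.
Qed.

End MainStep.

(** * Finitely many pencils suffice *)

Section Induction.
Variables (R : realType) (g : nat).
Variable W : graded R g.
Hypothesis Wsym : graded_set W.
Hypothesis Wbmc : bounded_matrix_convex W.
Variables (I : finType) (d : I -> nat) (p : forall i, ncpoly R g (d i)).
Hypothesis exitW : detects_exit W p.

Definition pos_on l (A : mxtuple R g l) : Prop :=
  forall n (X : mxtuple R g n), (0 < n)%N -> W X -> pencil_pos A X.

(** These are the boundary points that [A] fails to exclude. *)
Definition missed l (A : mxtuple R g l) n (X : mxtuple R g n) : Prop :=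
  on_boundary W X /\ pencil_pos A X.

(** One letter more than the degree, because applying a pencil to orbit vectors appends a letter. *)
Local Notation orb := (orbit_mx (max_degree p).+1).

Lemma missed_dsum l (A : mxtuple R g l) n m (X : mxtuple R g n) (Y : mxtuple R g m) :
  (0 < n)%N -> (0 < m)%N -> missed A X -> missed A Y -> missed A (dsum X Y).
Proof.
move=> n0 m0 [bX AX] [bY AY]; split; first exact: (boundary_dsum Wbmc).
exact: pencil_pos_dsum.
Qed.

(* A missed point at which as many of the [p i] as possible are singular:
   by direct sums these are then all the [p i] singular at some missed point. *)
Lemma maximal_singular l (A : mxtuple R g l) n (X : mxtuple R g n) :
  (0 < n)%N -> missed A X ->
  exists m (Y : mxtuple R g m), [/\ (0 < m)%N, missed A Y &
    forall i k (Z : mxtuple R g k), (0 < k)%N -> missed A Z ->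
      nceval (p i) Z \notin unitmx -> nceval (p i) Y \notin unitmx].
Proof.
move=> n0 AX; pose sing m (Y : mxtuple R g m) :=
  [pred i | nceval (p i) Y \notin unitmx].
have [||c [m [Y [m0 AY <-]]] maxc] := @exists_max_nat (fun c =>
    exists m (Y : mxtuple R g m), [/\ (0 < m)%N, missed A Y & #|sing m Y| = c]) #|I|.
- by exists #|sing n X|, n, X.
- by move=> _ [m [Y [_ _ <-]]]; exact: max_card.
exists m, Y; split=> // i k Z k0 AZ Zi.
have sub : sing m Y \subset sing (m + k)%N (dsum Y Z).
  by apply/fintype.subsetP => j; rewrite !inE; exact: nonunit_dsuml.
have : sing (m + k)%N (dsum Y Z) =i sing m Y.
  apply/fsym/subset_cardP => //; apply/eqP; rewrite eqn_leq subset_leq_card //=.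
  apply: maxc; exists (m + k)%N, (dsum Y Z); split=> //; first by rewrite addn_gt0 m0.
  exact: missed_dsum.
by move=> /(_ i); rewrite !inE nonunit_dsumr // => ->.
Qed.

(** [b] is the largest orbit rank at missed points, reached where the relations are fewest. There
    [B] has a kernel vector combined from orbit vectors; where [B] is positive this combination must
    vanish, an additional relation that lowers the rank. *)
Lemma rank_drop l (A : mxtuple R g l) n (X : mxtuple R g n) :
  (0 < n)%N -> missed A X ->
  exists r (B : mxtuple R g r) b, [/\ symtuples B, pos_on B,
    exists m (Y : mxtuple R g m) V,
      [/\ (0 < m)%N, missed A Y, kernel_pair p Y V & \rank (orb Y V) = b] &
    forall k (Z : mxtuple R g k) V, (0 < k)%N -> missed A Z -> pencil_pos B Z ->
      kernel_pair p Z V -> (\rank (orb Z V) < b)%N].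
Proof.
move=> n0 AX; have [n1 [X1 [n10 AX1 X1max]]] := maximal_singular n0 AX.
have [V1 kV1 V1n0] : exists2 V1 : row_family R d n1, kernel_pair p X1 V1 &
    forall i, nceval (p i) X1 \notin unitmx -> V1 i != 0.
  have : forall i, exists V : 'M[R]_(d i, n1), poly_apply (p i) X1 V = 0 /\
      (nceval (p i) X1 \notin unitmx -> V != 0).
    move=> i; have [u|/poly_apply_nonunit[V V0 pV]] := boolP (nceval (p i) X1 \in unitmx).
      by exists 0; split=> //; exact: poly_apply0.
    by exists V.
  move=> /fin_all_exists[V1 V1P]; exists V1 => i; first exact: (V1P i).1.
  exact: (V1P i).2.
have [||b [n2 [X2 [V2 [n20 AX2 kV2 bE]]]] bmax] := @exists_max_nat (fun b =>
    exists m (Y : mxtuple R g m) V,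
      [/\ (0 < m)%N, missed A Y, kernel_pair p Y V & \rank (orb Y V) = b])
    #|{: orbit_index g d (max_degree p).+1}|.
- by exists (\rank (orb X1 V1)), n1, X1, V1.
- by move=> _ [m [Y [V [_ _ _ <-]]]]; exact: rank_leq_row.
(* [X1] brings all possible singularities, [X2] the maximal rank; the direct sum has both. *)
pose N := (n1 + n2)%N; pose Y : mxtuple R g N := dsum X1 X2.
pose V : row_family R d N := row_family_dsum V1 V2.
have N0 : (0 < N)%N by rewrite addn_gt0 n10.
have AY : missed A Y by exact: missed_dsum.
have kV : kernel_pair p Y V by exact: kernel_pair_dsum.
have rYV : \rank (orb Y V) = b.
  apply/eqP; rewrite eqn_leq bmax /=; last by exists N, Y, V.
  by rewrite -bE [orb Y V]orbit_mx_dsum mulmx_row_mx_rank.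
(* Adjoining [Z] to [Y] cannot raise the maximal rank, so every relation between the orbit vectors
   of [Y] holds for those of [Z]. *)
have dominated k (Z : mxtuple R g k) VZ : (0 < k)%N -> missed A Z ->
    kernel_pair p Z VZ -> exists D, orb Z VZ = orb Y V *m D.
  move=> k0 AZ kZ; apply: row_mx_factor_rank; rewrite rYV -orbit_mx_dsum; apply: bmax.
  exists (N + k)%N, (dsum Y Z), (row_family_dsum V VZ); split=> //.
  - by rewrite addn_gt0 N0.
  - exact: missed_dsum.
  - exact: kernel_pair_dsum.
have [P [Ps Pi MP [E PE]]] := orth_projection (orbit_mx (max_degree p) Y V).
have [bY posAY] := AY; have [Ys YW Yr] := bY.
have bPY : on_boundary W (conjtuple P Y).
  apply: (boundary_compression Wbmc exitW N0 bY kV Ps Pi MP) => s i s01 bs nu.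
  (* A boundary point on the path is again missed by [A], so [p i] is already singular at [X1]. *)
  have : V1 i != 0.
    apply: V1n0; apply: (X1max i _ _ N0) nu; split=> //.
    by apply: pencil_pos_conj => //; exact: contractive_shrink.
  by apply: contra; rewrite row_mx_eq0 => /andP[].
have [r [B [Z [Bs Z0 posB BZ]]]] := effros_winkler Wsym Wbmc N0 bPY.
exists r, B, b; split=> //; first by exists N, Y, V.
(* The equation [B(P Y P) Z = 0] expresses [Z] through terms ending in [P]. *)
have ZP : Z *m P = Z.
  have -> : Z = (- \sum_j B j *m Z *m (P^T *m Y j)) *m P.
    rewrite mulNmx mulmx_suml; apply/eqP; rewrite -addr_eq0; apply/eqP.
    rewrite -[RHS]BZ; congr (_ + _); apply: eq_bigr => j _.
    by rewrite /conjtuple !mulmxA.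
  by rewrite -mulmxA Pi.
pose C := Z *m E.
have ZC : Z = C *m orbit_mx (max_degree p) Y V by rewrite -mulmxA -PE.
(* As [Z P = Z], the form at [Y] has the same value as at [P Y P], namely zero; it is nonnegative as
   a limit from [W]. *)
have BYZ : pencil_apply B Y Z = 0.
  apply: pencil_form_ge0_ker => // [U|].
    have := @affine_ge0 R (ip U U) (pencil_form B Y U - ip U U).
    rewrite subrKC; apply => s s01.
    have := posB _ _ N0 (Yr s s01) U; rewrite pencil_form_scale => pos.
    have [->|/pos/ltW] := eqVneq U 0; last by congr (_ <= _); ring.
    by rewrite /pencil_form !(ipC 0) !ip0r subr0 mulr0 addr0.
  have := pencil_form_conj B Y P Z; rewrite Ps ZP subrr addr0 => <-.
  by rewrite /pencil_form BZ ip0r.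
have [S0 S0E] := @orbit_mx_widen R g I d (max_degree p).
have /fin_all_exists[S SE] := @orbit_mx_shift R g I d (max_degree p).
(* [rel] applies [B] to the combination [C] of orbit vectors, with the same coefficients at every
   point. *)
pose rel := C *m S0 + \sum_j B j *m C *m S j.
have relE k (X' : mxtuple R g k) V' :
    pencil_apply B X' (C *m orbit_mx (max_degree p) X' V') = rel *m orb X' V'.
  rewrite /pencil_apply /rel mulmxDl -mulmxA -S0E mulmx_suml; congr (_ + _).
  by apply: eq_bigr => j _; rewrite -!mulmxA SE.
move=> k X' V' k0 AX' posB' kX'.
have [D orbE] := dominated _ _ _ k0 AX' kX'.
(* The relation [rel] passes from [Y] to [X'], where positivity of [B] makes the combination itself
   vanish. *)
have C0 : C *m orbit_mx (max_degree p) X' V' = 0.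
  apply: contraPeq isT => /posB'; rewrite /pencil_form relE orbE mulmxA -relE -ZC BYZ.
  by rewrite mul0mx ip0r ltxx.
rewrite ltnNge; apply/negP => brank.
(* Without a drop in rank the new relation would hold at [Y] too, where the combination is the
   nonzero [Z]. *)
have [|F orbF] := mulmx_factor_rank (ex_intro _ D orbE); first by rewrite rYV.
move/eqP: Z0; apply.
by rewrite ZC S0E orbF mulmxA mulmxA -(mulmxA C) -S0E C0 mul0mx.
Qed.

(** Induction on a strict bound [b] for the orbit ranks at missed points; each pencil from
    [rank_drop] is added as a direct summand. *)
Lemma finite_pencil : exists l (A : mxtuple R g l),
  [/\ (0 < l)%N, symtuples A, pos_on A &
      forall n (X : mxtuple R g n), (0 < n)%N -> ~ missed A X].
Proof.
suff step b : forall l (A : mxtuple R g l), (0 < l)%N -> symtuples A -> pos_on A ->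
    (forall n (X : mxtuple R g n) V, (0 < n)%N -> missed A X -> kernel_pair p X V ->
      (\rank (orb X V) < b)%N) ->
    exists l (A : mxtuple R g l), [/\ (0 < l)%N, symtuples A, pos_on A &
      forall n (X : mxtuple R g n), (0 < n)%N -> ~ missed A X].
  (* The start is the constant pencil of size 1; the number of rows bounds the rank. *)
  apply: (step #|{: orbit_index g d (max_degree p).+1}|.+1 1%N 0) => //.
  - by move=> j; rewrite trmx0.
  - move=> n X n0 WX Z Z0; rewrite /pencil_form /pencil_apply big1 ?addr0 ?ip_gt0 //.
    by move=> j _; rewrite !mul0mx.
  - by move=> n X V _ _ _; rewrite ltnS rank_leq_row.
elim: b => [|b IH] l A l0 As posA rA.
  exists l, A; split=> // n X n0 AX.
  (* The zero family is always a kernel pair, so the bound zero leaves no missed point. *)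
  have /(rA n X _ n0 AX) : kernel_pair p X (fun=> 0) by move=> i; exact: poly_apply0.
  by rewrite ltn0.
have [[n [X [n0 AX]]]|none] := pselect (exists n (X : mxtuple R g n),
    (0 < n)%N /\ missed A X); last first.
  by exists l, A; split=> // n X n0 AX; apply: none; exists n, X.
have [r [B [c [Bs posB [m [Y [V [m0 AY kV rc]]]] drop]]]] := rank_drop n0 AX.
apply: (IH (l + r)%N (dsum A B)).
- by rewrite addn_gt0 l0.
- exact: symtuples_dsum.
- by move=> k Z k0 WZ; apply/pencil_pos_dsuml; split; [exact: posA|exact: posB].
move=> k Z V' k0 [bZ /pencil_pos_dsuml[AZ BZ]] kZ.
apply: leq_trans (drop k Z V' k0 _ BZ kZ) _ => //.
(* The rank [c] is attained at a point missed by [A], whence [c <= b]. *)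
by rewrite -ltnS -rc rA.
Qed.

(** A point outside [W] in the domain of [A] would have a boundary point of [W] on its ray, where
    [A] is still positive because its form is affine along rays. *)
Lemma detects_exit_LMI : LMI_representation W.
Proof.
have [l [A [l0 As posA nomiss]]] := finite_pencil.
exists l; split=> //; exists A => // n n0; apply/seteqP; split=> [X WX|X [Xs]].
  have Xs := Wsym n0 WX; split=> //; apply/posdef_pencil => //; exact: posA.
move=> /(posdef_pencil As Xs) AX; have [//|nW] := pselect (W X).
have [t /andP[t0 t1] bt] := boundary_on_ray Wbmc n0 Xs nW.
case: (nomiss n (scale_tuple t X) n0); split=> // Z Z0; rewrite pencil_form_scale.
by rewrite ltr_wpDl ?mulr_ge0 ?subr_ge0 ?ip_ge0 // mulr_gt0 // AX.
Qed.

End Induction.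

(** * Semialgebraic sets *)

(** Adjoining to the component a point of its closure leaves it connected. *)
Lemma connected_component_closed_in (T : topologicalType) (S : set T) x y :
  closure (connected_component S x) y -> S y -> connected_component S x y.
Proof.
set C := connected_component S x => Cy Sy.
have [Sx|Sx] := pselect (S x); last first.
  have [z [+ _]] := Cy _ filterT.
  by rewrite /C connected_component_out.
have CS : C `<=` S by exact: connected_component_sub.
exists (C `|` [set y]); last by right.
split; first by left; exact: connected_component_refl.
  by rewrite subUset; split=> // _ ->.
have sub : C `|` [set y] `<=` closure C.
  by rewrite subUset; split; [exact: subset_closure|move=> _ ->].
(* A nonempty relatively clopen [U] meets the component, hence contains it; being cut out by the
   closed set [K], it contains [y] as well. *)
move=> U [u Uu] [V oV UV] [K cK UK]; have CE : C = C `&` V.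
  apply/esym/component_connected.
  - have [/sub Cu Vu] : ((C `|` [set y]) `&` V) u by rewrite -UV.
    exact: Cu (open_nbhs_nbhs _).
  - by exists V.
  - exists K => //; apply/seteqP; split=> z [Cz].
      move=> Vz; split=> //; have : U z by rewrite UV; split=> //; left.
      by rewrite UK => -[].
    move=> Kz; split=> //; have : U z by rewrite UK; split=> //; left.
    by rewrite UV => -[].
have CK : closure C `<=` K.
  rewrite (closure_id K).1 //; apply: closureS => z Cz.
  have : U z by rewrite UV; split; [left|move: Cz; rewrite CE => -[]].
  by rewrite UK => -[].
by apply/seteqP; split=> z; rewrite UK; [case|move=> Bz; split=> //; exact/CK/sub].
Qed.

Lemma closure_finite_union (T : topologicalType) (I : finType) (A : I -> set T)
    (S : set T) x :
  closure S x -> S `<=` \bigcup_i A i -> exists i, closure (S `&` A i) x.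
Proof.
move=> Sx SA; apply: contrapT => /forallNP none.
have near_none : \forall y \near x, forall i, ~ (S `&` A i) y.
  apply: (@filter_forall _ _ (fun i y => ~ (S `&` A i) y) (nbhs x) _) => i.
  apply: contrapT => near_i; apply: (none i) => B Bx; apply: contrapT => empty.
  apply: near_i; apply: filterS Bx => y By SAy; apply: empty.
  by exists y.
have [y [Sy Ny]] := Sx _ near_none.
by have [i _ Ay] := SA y Sy; apply: (Ny i).
Qed.

Section Exit.
Variables (R : realType) (g : nat).

(** [X] is outside the union, since components are relatively closed; as the union is finite, [T]
    accumulates at [X] within a single piece [B k]. *)
Lemma detects_exit_union (W : graded R g) t (B : 'I_t -> graded R g) (s : 'I_t -> nat)
    (d : forall k, 'I_(s k) -> nat) (p : forall k (j : 'I_(s k)), ncpoly R g (d k j)) :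
  graded_eq W (pc (graded_union B)) ->
  (forall k n (X : mxtuple R g n), (0 < n)%N -> symtuples X ->
     closure (@B k n) X -> ~ B k n X ->
     exists j, (forall Y : mxtuple R g n, B k n Y -> nceval (p k j) Y \in unitmx) /\
       nceval (p k j) X \notin unitmx) ->
  detects_exit W (fun i : {k : 'I_t & 'I_(s k)} => p (tag i) (tagged i)).
Proof.
move=> WE BP n T X n0 TW Xs nWX clT.
have WEn : @W n = connected_component (graded_union B (n := n)) 0 := WE n n0.
have WS : @W n `<=` graded_union B (n := n).
  by rewrite WEn; exact: connected_component_sub.
have nSX : ~ graded_union B X.
  move=> SX; apply: nWX; rewrite WEn; apply: connected_component_closed_in SX.
  by apply: closureS clT; rewrite -WEn.
have [|k clk] := closure_finite_union (A := fun k => @B k n) clT.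
  exact: subset_trans TW WS.
have nBX : ~ B k n X by move=> BX; apply: nSX; exists k.
have [Y [[TY BY] _]] := clk _ filterT.
have [j [unitB nX]] := BP k n X n0 Xs (closureS (@subIsetr _ _ _) clk) nBX.
by exists (existT _ k j), Y; split=> //; exact: unitB.
Qed.

End Exit.

Theorem theorem9p5 (R : realType) (g : nat) (W : graded R g) :
  (0 < g)%N ->
  graded_set W ->
  graded_bounded W ->
  bounded_matrix_convex W ->
  (exists S : graded R g, free_open S /\ graded_eq W (pc S)) \/
  (exists (t : nat) (s : 'I_t -> nat) (d : forall k : 'I_t, 'I_(s k) -> nat)
      (p : forall (k : 'I_t) (j : 'I_(s k)), ncpoly R g (d k j)),
      (forall k j, admissible (p k j)) /\
      graded_eq W
        (pc (graded_union (fun k : 'I_t =>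
               graded_inter (fun j : 'I_(s k) => invset (p k j)))))) ->
  LMI_representation W.
Proof.
move=> _ Wsym _ Wbmc [[S [[t [B [Bbasic SB]]] WS]]|[t [s [d [p [_ WS]]]]]].
- pose family := {s : nat & {d : 'I_s -> nat & forall j, ncpoly R g (d j)}}.
  have /fin_all_exists[u uB] : forall k, exists u : family,
      graded_eq (B k) (graded_inter (fun j => pcinvset (projT2 (projT2 u) j))).
    by move=> k; have [s [d [p [_ BE]]]] := Bbasic k; exists (existT _ s (existT _ d p)).
  apply: (detects_exit_LMI Wsym Wbmc (@detects_exit_union R g W t B
    (fun k => projT1 (u k)) (fun k => projT1 (projT2 (u k)))
    (fun k => projT2 (projT2 (u k))) _ _)).
    by move=> n n0; rewrite WS // /pc SB.
  move=> k n X n0 Xs; rewrite (uB k n n0) => clX nX.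
  have [j nXj] : exists j, ~ pcinvset (projT2 (projT2 (u k)) j) X.
    by apply: contrapT => /forallNP all; apply: nX; split=> // j _; exact: contrapT.
  exists j; split=> [Y [_ /(_ j I)]|].
    by move=> /connected_component_sub[].
  (* Were the polynomial invertible at [X], then [X], a limit of points of the component, would
     belong to it. *)
  apply/negP => uX; apply: nXj; apply: connected_component_closed_in => //.
  by apply: closureS clX => Y [_ /(_ j I)].
- apply: (detects_exit_LMI Wsym Wbmc (@detects_exit_union R g W t _ s d p WS _)).
  move=> k n X n0 Xs _ nX.
  have [j nXj] : exists j, ~ invset (p k j) X.
    by apply: contrapT => /forallNP all; apply: nX; split=> // j _; exact: contrapT.
  exists j; split=> [Y [_ /(_ j I)[]]|] //.
  by apply/negP => uX; apply: nXj.
Qed.
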